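(* Let $R$ be a commutative unital ring, let $X$ be a subshift over a non-empty alphabet $\mathscr{A}$, and let $(A,c)$ be a minimal cycle without exit. Then $$\psi:p_A\widetilde{\mathcal{A}}_R(X)p_A\to R[x,x^{-1}]$$ given ($R$-linearly) by $\psi(s_c^np_A)=x^n$ for all $n\in\mathbb{Z}$ is an $R$-algebra isomorphism, where $R[x,x^{-1}]$ is the Laurent polynomial algebra.
   Context: Conventions: $\mathbb{N}=\{0,1,2,\ldots\}$. $\mathscr{A}$ is a non-empty (possibly infinite) set, the alphabet; $\mathscr{A}^*$ is the set of finite words over $\mathscr{A}$, $\omega$ the empty word, $|\alpha|$ the length of a word, $\beta\alpha$ concatenation, $\alpha^n$ the $n$-fold concatenation, and $\alpha^\infty=\alpha\alpha\alpha\cdots$. A subshift $X\subseteq\mathscr{A}^{\mathbb{N}}$ is a set of the form $X=X_F$ for some $F\subseteq\mathscr{A}^*$, where $X_F$ is the set of all sequences in $\mathscr{A}^{\mathbb{N}}$ containing no word of $F$ as a (consecutive) subword. The language $\mathcal{L}_X$ is the set of all finite words (including $\omega$) that appear in some sequence of $X$. For $\alpha,\beta\in\mathcal{L}_X$ let $C(\alpha,\beta)=\{\beta x\in X:\alpha x\in X\}$; note $X=C(\omega,\omega)$. $\mathcal{U}$ is the Boolean algebra of subsets of $X$ generated by all $C(\alpha,\beta)$, $\alpha,\beta\in\mathcal{L}_X$. The unital subshift algebra $\widetilde{\mathcal{A}}_R(X)$ is the universal unital $R$-algebra with generators $\{p_A:A\in\mathcal{U}\}$ and $\{s_a,s_a^*:a\in\mathscr{A}\}$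 subject to: (i) $p_X=1$, $p_{A\cap B}=p_Ap_B$, $p_{A\cup B}=p_A+p_B-p_{A\cap B}$, $p_\emptyset=0$ for all $A,B\in\mathcal{U}$; (ii) $s_as_a^*s_a=s_a$ and $s_a^*s_as_a^*=s_a^*$ for all $a\in\mathscr{A}$; (iii) $s_\beta s_\alpha^*s_\alpha s_\beta^*=p_{C(\alpha,\beta)}$ for all $\alpha,\beta\in\mathcal{L}_X$, where $s_\omega=s_\omega^*=1$ and, for $\alpha=\alpha(1)\cdots\alpha(n)$, $s_\alpha=s_{\alpha(1)}\cdots s_{\alpha(n)}$ and $s_\alpha^*=s_{\alpha(n)}^*\cdots s_{\alpha(1)}^*$. For $n<0$, $s_c^n$ means $(s_c^* )^{-n}$, and $s_c^0=1$. For $A\in\mathcal{U}$ and $\alpha\in\mathcal{L}_X$ the relative range is $r(A,\alpha)=\{x\in X:\alpha x\in A\}$. A cycle is a pair $(A,\alpha)$ with $\alpha\in\mathcal{L}_X\setminus\{\omega\}$, $\emptyset\neq A\in\mathcal{U}$ and $A\subseteq r(A,\alpha)$. It is a cycle without exit if $A=\{\alpha^\infty\}$. A cycle without exit $(A,\alpha)$ is minimal if there is no $\beta\in\mathcal{L}_X$ with $1\leq|\beta|<|\alpha|$ such that $\alpha=\beta^k$ for some $k\geq 2$.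
   Formalization: The formal theorem also assumes that every letter of the alphabet occurs in X; otherwise an unused letter a gives a generator s_a constrained only by relation (ii), and the claim fails over any nonzero R (e.g. alphabet {c,a}, X = {c^∞}). *)

(* Defs.v *)
From HB Require Import structures.
From mathcomp Require Import all_boot all_order all_algebra.
From mathcomp Require Import finmap generic_quotient.
From mathcomp Require Import boolp classical_sets functions cardinality fsbigop.

Set Implicit Arguments.
Unset Strict Implicit.
Unset Printing Implicit Defensive.

Import GRing.Theory.
Local Open Scope classical_set_scope.
Local Open Scope quotient_scope.
Local Open Scope ring_scope.

(* [algType R] of MathComp requires [1 != 0] in the algebra, which a universal
   algebra over an arbitrary commutative ring need not satisfy; and there is no
   structure joining [pzRingType] and [lmodType R]. *)
Record pzAlgType (R : comPzRingType) := PzAlgType {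
  alg_ring : pzRingType;
  alg_scale : R -> alg_ring -> alg_ring;
  alg_scaleA : forall a b v, alg_scale a (alg_scale b v) = alg_scale (a * b) v;
  alg_scale1 : left_id 1 alg_scale;
  alg_scaleDr : right_distributive alg_scale +%R;
  alg_scaleDl : forall v, {morph alg_scale^~ v : a b / a + b};
  alg_scaleAl : forall k x y, alg_scale k (x * y) = alg_scale k x * y;
  alg_scaleAr : forall k x y, alg_scale k (x * y) = x * alg_scale k y
}.

Definition alg_sort (R : comPzRingType) (A : pzAlgType R) : Type := alg_ring A.
Coercion alg_sort : pzAlgType >-> Sortclass.

HB.instance Definition _ R (A : pzAlgType R) :=
  GRing.PzRing.copy (alg_sort A) (alg_ring A).
HB.instance Definition _ R (A : pzAlgType R) :=
  GRing.Zmodule_isLmodule.Build R (alg_sort A)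
    (@alg_scaleA R A) (@alg_scale1 R A) (@alg_scaleDr R A) (@alg_scaleDl R A).

Lemma pzscalerAl (R : comPzRingType) (A : pzAlgType R) (k : R) (x y : A) :
  k *: (x * y) = (k *: x) * y.
Proof. exact: alg_scaleAl. Qed.

Lemma pzscalerAr (R : comPzRingType) (A : pzAlgType R) (k : R) (x y : A) :
  k *: (x * y) = x * (k *: y).
Proof. exact: alg_scaleAr. Qed.

Notation alg_hom f := (linear f /\ monoid_morphism f).

Section AlgHom.
Context (R : comPzRingType) (A B : pzAlgType R) (f : A -> B) (hf : alg_hom f).

Lemma alg_homD : {morph f : x y / x + y}.
Proof. by move=> x y; rewrite -[x]scale1r hf.1 !scale1r. Qed.

Lemma alg_hom0 : f 0 = 0.
Proof. by apply: (addrI (f 0)); rewrite -alg_homD !addr0. Qed.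

Lemma alg_homZ k x : f (k *: x) = k *: f x.
Proof. by rewrite -[k *: x]addr0 hf.1 alg_hom0 addr0. Qed.

Lemma alg_homN : {morph f : x / - x}.
Proof. by move=> x; rewrite -scaleN1r alg_homZ scaleN1r. Qed.

Lemma alg_homM : {morph f : x y / x * y}. Proof. exact: hf.2.2. Qed.

Lemma alg_hom1 : f 1 = 1. Proof. exact: hf.2.1. Qed.

Lemma alg_hom_prod I (r : seq I) (F : I -> A) :
  f (\prod_(i <- r) F i) = \prod_(i <- r) f (F i).
Proof. by apply: (big_morph f alg_homM alg_hom1). Qed.

End AlgHom.

Definition corner_set (A : pzRingType) (e : A) : set A :=
  [set e * a * e | a in [set: A]].

Definition in_corner (A : pzRingType) (e : A) : {pred A} :=
  fun x => x \in corner_set e.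

(* The algebra [e A e], whose unit is [e]; idempotency of [e] is needed for
   the ring structure below. *)
Record corner (A : pzRingType) (e : A) (he : e * e = e) := Corner {
  corner_val :> A;
  corner_valP : in_corner e corner_val
}.
Arguments Corner {A e} he corner_val corner_valP.

HB.instance Definition _ A e he := [isSub for @corner_val A e he].
HB.instance Definition _ A e he := [Choice of @corner A e he by <:].

Section Corner.
Context (R : comPzRingType) (A : pzAlgType R) (e : A) (he : e * e = e).

Lemma corner_setE x : (x \in corner_set e) = (e * x * e == x).
Proof.
apply/idP/eqP => [|<-]; last by apply/mem_set; exists x.
by move=> /set_mem[a _ <-]; rewrite !mulrA he -!mulrA he.
Qed.

Fact corner_zmod_closed : zmod_closed (in_corner e).
Proof.
split=> [|x y]; rewrite -!topredE /= /in_corner !corner_setE ?mulr0 ?mul0r //.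
by move=> /eqP hx /eqP hy; rewrite mulrBr mulrBl hx hy.
Qed.
HB.instance Definition _ := GRing.isZmodClosed.Build A
  (in_corner e) corner_zmod_closed.
HB.instance Definition _ := [SubChoice_isSubZmodule of corner he by <:].

Lemma corner_valD (x y : corner he) :
  corner_val (x + y) = corner_val x + corner_val y.
Proof. by rewrite -[LHS]/(val (x + y)) raddfD. Qed.

Fact corner_scale_subproof k (x : corner he) : in_corner e (k *: val x).
Proof.
rewrite /in_corner corner_setE -pzscalerAr -pzscalerAl.
by have := valP x; rewrite /in_corner corner_setE => /eqP ->.
Qed.
Definition corner_scale k (x : corner he) : corner he :=
  Corner he _ (corner_scale_subproof k x).

Fact corner_scaleA a b (v : corner he) :
  corner_scale a (corner_scale b v) = corner_scale (a * b) v.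
Proof. by apply: val_inj; rewrite /= scalerA. Qed.
Fact corner_scale1 : left_id 1 corner_scale.
Proof. by move=> v; apply: val_inj; rewrite /= scale1r. Qed.
Fact corner_scaleDr : right_distributive corner_scale +%R.
Proof. by move=> k u v; apply: val_inj; rewrite /= scalerDr. Qed.
Fact corner_scaleDl (v : corner he) :
  {morph corner_scale^~ v : a b / a + b}.
Proof. by move=> a b; apply: val_inj; rewrite /= scalerDl. Qed.
HB.instance Definition _ := GRing.Zmodule_isLmodule.Build R (corner he)
  corner_scaleA corner_scale1 corner_scaleDr corner_scaleDl.

Fact corner_one_subproof : in_corner e e.
Proof. by rewrite /in_corner corner_setE !he. Qed.
Definition corner_one : corner he := Corner he e corner_one_subproof.

Fact corner_mul_subproof (x y : corner he) : in_corner e (val x * val y).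
Proof.
rewrite /in_corner corner_setE; have /set_mem[a _ <-] := valP x.
by have /set_mem[b _ <-] := valP y; rewrite !mulrA he -!mulrA he.
Qed.
Definition corner_mul (x y : corner he) : corner he :=
  Corner he _ (corner_mul_subproof x y).

Fact corner_mulA : associative corner_mul.
Proof. by move=> x y z; apply: val_inj; rewrite /= mulrA. Qed.
Fact corner_mul1l : left_id corner_one corner_mul.
Proof.
move=> x; apply: val_inj => /=; have /set_mem[a _ <-] := valP x.
by rewrite !mulrA he.
Qed.
Fact corner_mul1r : right_id corner_one corner_mul.
Proof.
move=> x; apply: val_inj => /=; have /set_mem[a _ <-] := valP x.
by rewrite -!mulrA he.
Qed.
Fact corner_mulDl : left_distributive corner_mul +%R.
Proof. by move=> x y z; apply: val_inj; rewrite /= mulrDl. Qed.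
Fact corner_mulDr : right_distributive corner_mul +%R.
Proof. by move=> x y z; apply: val_inj; rewrite /= mulrDr. Qed.
HB.instance Definition _ := GRing.Zmodule_isPzRing.Build (corner he)
  corner_mulA corner_mul1l corner_mul1r corner_mulDl corner_mulDr.

Fact corner_scaleAl k (x y : corner he) : k *: (x * y) = (k *: x) * y.
Proof. by apply: val_inj; rewrite /= pzscalerAl. Qed.
Fact corner_scaleAr k (x y : corner he) : k *: (x * y) = x * (k *: y).
Proof. by apply: val_inj; rewrite /= pzscalerAr. Qed.
End Corner.

Definition laurent_set (R : pzRingType) : set (int -> R) :=
  [set f | finite_set (f @^-1` [set~ 0])].
Arguments laurent_set R : clear implicits.

Definition in_laurent (R : pzRingType) : {pred int -> R} :=
  fun f => f \in laurent_set R.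

Record laurent (R : pzRingType) := Laurent {
  lcoef :> int -> R;
  lcoefP : in_laurent lcoef
}.

HB.instance Definition _ R := [isSub for @lcoef R].
HB.instance Definition _ R := [Choice of @laurent R by <:].

Section Laurent.
Context (R : comPzRingType).
Implicit Types f g h : laurent R.

Lemma laurent_setP (f : int -> R) :
  reflect (exists A : {fset int}, forall k, k \notin A -> f k = 0)
          (in_laurent f).
Proof.
apply: (iffP idP) => [/set_mem fin_f|[A fA]].
  exists (fset_set (f @^-1` [set~ 0])) => k; rewrite in_fset_set //.
  by move=> /negP; apply: contra_notP => fk; apply/mem_set.
apply/mem_set; apply: (finite_subfset A) => k /=.
by apply: contra_notT => /fA.
Qed.

Lemma laurent_supp f : exists A : {fset int}, forall k, k \notin A -> f k = 0.
Proof. exact/laurent_setP/lcoefP. Qed.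

Fact laurent_zmod_closed : zmod_closed (@in_laurent R).
Proof.
split=> [|f g]; rewrite -!topredE /=.
  by apply/laurent_setP; exists fset0.
move=> /laurent_setP[A fA] /laurent_setP[B gB]; apply/laurent_setP.
exists (A `|` B)%fset => k; rewrite in_fsetU negb_or => /andP[kA kB].
by rewrite !fctE fA // gB // subr0.
Qed.
HB.instance Definition _ := GRing.isZmodClosed.Build (int -> R)
  (@in_laurent R) laurent_zmod_closed.
HB.instance Definition _ := [SubChoice_isSubZmodule of laurent R by <:].

Lemma laurentP f g : (forall n, f n = g n) -> f = g.
Proof. by move=> fg; apply: val_inj; apply/funext. Qed.

Lemma lcoefD f g n : (f + g) n = f n + g n.
Proof. by rewrite -[LHS]/(val (f + g) n) raddfD. Qed.

Fact laurent_scale_subproof (k : R) f :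
  in_laurent (fun n => k * f n).
Proof.
have [A fA] := laurent_supp f; apply/laurent_setP.
by exists A => n /fA ->; rewrite mulr0.
Qed.
Definition laurent_scale k f : laurent R := Laurent (laurent_scale_subproof k f).

Fact laurent_scaleA a b f :
  laurent_scale a (laurent_scale b f) = laurent_scale (a * b) f.
Proof. by apply: laurentP => n; rewrite /= mulrA. Qed.
Fact laurent_scale1 : left_id 1 laurent_scale.
Proof. by move=> f; apply: laurentP => n; rewrite /= mul1r. Qed.
Fact laurent_scaleDr : right_distributive laurent_scale +%R.
Proof. by move=> k f g; apply: laurentP => n; rewrite /= mulrDr. Qed.
Fact laurent_scaleDl f : {morph laurent_scale^~ f : a b / a + b}.
Proof. by move=> a b; apply: laurentP => n; rewrite /= mulrDl. Qed.
HB.instance Definition _ := GRing.Zmodule_isLmodule.Build R (laurent R)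
  laurent_scaleA laurent_scale1 laurent_scaleDr laurent_scaleDl.

Fact laurentX_subproof (n : int) :
  in_laurent (fun k => (k == n)%:R : R).
Proof.
apply/laurent_setP; exists [fset n]%fset => k.
by rewrite in_fset1 => /negbTE ->.
Qed.

(* The monomial [x ^ n], for [n] of either sign. *)
Definition laurentX n : laurent R := Laurent (laurentX_subproof n).

Definition laurent_conv f g (n : int) : R :=
  \sum_(k \in [set: int]) f k * g (n - k).

Lemma laurent_convE (A : {fset int}) f g n :
    (forall k, k \notin A -> f k = 0) ->
  laurent_conv f g n = \sum_(k <- A) f k * g (n - k).
Proof. by move=> fA; apply: fsbigTE => k /fA ->; rewrite mul0r. Qed.

Lemma laurent_conv0 (A B : {fset int}) f g n :
    (forall k, k \notin A -> f k = 0) -> (forall k, k \notin B -> g k = 0) ->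
  n \notin [fset (i + j)%R | i in A, j in B]%fset -> laurent_conv f g n = 0.
Proof.
move=> fA gB nAB; rewrite (laurent_convE _ _ fA) big_seq big1 // => k kA.
rewrite gB ?mulr0 //; apply: contra nAB => kB.
by apply/imfset2P; exists k => //; exists (n - k) => //; rewrite addrC subrK.
Qed.

Fact laurent_mul_subproof f g : in_laurent (laurent_conv f g).
Proof.
have [A fA] := laurent_supp f; have [B gB] := laurent_supp g.
apply/laurent_setP; exists [fset (i + j)%R | i in A, j in B]%fset => n.
exact: laurent_conv0.
Qed.
Definition laurent_mul f g : laurent R := Laurent (laurent_mul_subproof f g).

Lemma laurent_shift (B S : {fset int}) (i : int) (F : int -> R) :
    (forall j, j \notin B -> F j = 0) ->
    (forall m, m \notin S -> F (m - i) = 0) ->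
  \sum_(m <- S) F (m - i) = \sum_(j <- B) F j.
Proof.
move=> FB FS; rewrite -(fsbigTE S (fun m => F (m - i)) FS) -(fsbigTE B F FB).
rewrite (reindex_fsbigT (fun j => j - i) F) //.
by exists (fun j => j + i) => j; rewrite ?subrK ?addrK.
Qed.

Fact laurent_mulA : associative laurent_mul.
Proof.
move=> f g h; apply: laurentP => n /=; apply/esym.
have [A fA] := laurent_supp f; have [B gB] := laurent_supp g.
pose S := [fset (i + j)%R | i in A, j in B]%fset.
have fgS m : m \notin S -> laurent_mul f g m = 0 by exact: laurent_conv0.
rewrite (laurent_convE _ _ fgS) (laurent_convE _ _ fA).
under eq_bigr => m _ do rewrite /= (laurent_convE _ _ fA) mulr_suml.
rewrite exchange_big /= big_seq [RHS]big_seq; apply: eq_bigr => i iA.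
under eq_bigr => m _ do rewrite -mulrA.
rewrite -mulr_sumr (laurent_convE _ _ gB); congr (_ * _).
rewrite -(@laurent_shift B S i (fun j => g j * h (n - i - j))).
- by apply: eq_bigr => m _; rewrite opprB addrA subrK.
- by move=> j /gB ->; rewrite mul0r.
move=> m mS; rewrite gB ?mul0r //; apply: contra mS => mB.
by apply/imfset2P; exists i => //; exists (m - i) => //; rewrite addrC subrK.
Qed.

Lemma laurent_mulXl n f m : laurent_mul (laurentX n) f m = f (m - n).
Proof.
rewrite /= (@laurent_convE [fset n]%fset) => [|k]; last first.
  by rewrite in_fset1 /= => /negbTE ->.
by rewrite big_seq_fset1 /= eqxx mul1r.
Qed.

Fact laurent_mulC : commutative laurent_mul.
Proof.
move=> f g; apply: laurentP => n /=; rewrite /laurent_conv.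
rewrite (reindex_fsbigT (fun k => n - k)) /=; last first.
  by exists (fun k => n - k) => k; rewrite opprB addrC subrK.
by apply: eq_fsbigr => k _; rewrite opprB addrCA subrr addr0 mulrC.
Qed.

Fact laurent_mul1l : left_id (laurentX 0) laurent_mul.
Proof. by move=> f; apply: laurentP => n; rewrite laurent_mulXl subr0. Qed.
Fact laurent_mul1r : right_id (laurentX 0) laurent_mul.
Proof. by move=> f; rewrite laurent_mulC laurent_mul1l. Qed.
Fact laurent_mulDr : right_distributive laurent_mul +%R.
Proof.
move=> f g h; apply: laurentP => n.
rewrite -[RHS]/(laurent_conv f g n + laurent_conv f h n) /=.
have [A fA] := laurent_supp f; rewrite !(laurent_convE _ _ fA) -big_split /=.
by apply: eq_bigr => k _; rewrite mulrDr.
Qed.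
Fact laurent_mulDl : left_distributive laurent_mul +%R.
Proof. by move=> f g h; rewrite ![laurent_mul _ h]laurent_mulC laurent_mulDr. Qed.
HB.instance Definition _ := GRing.Zmodule_isPzRing.Build (laurent R)
  laurent_mulA laurent_mul1l laurent_mul1r laurent_mulDl laurent_mulDr.
HB.instance Definition _ :=
  GRing.PzRing_hasCommutativeMul.Build (laurent R) laurent_mulC.

Fact laurent_scaleAl k f g : k *: (f * g) = (k *: f) * g.
Proof.
apply: laurentP => n /=; have [A fA] := laurent_supp f.
have kfA m : m \notin A -> (k *: f) m = 0 by move=> /fA /= ->; rewrite mulr0.
rewrite (laurent_convE _ _ fA) (laurent_convE _ _ kfA) mulr_sumr.
by apply: eq_bigr => m _; rewrite /= mulrA.
Qed.
Fact laurent_scaleAr k f g : k *: (f * g) = f * (k *: g).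
Proof. by rewrite mulrC laurent_scaleAl mulrC. Qed.
Lemma laurentX0 : laurentX 0 = 1. Proof. by []. Qed.

Lemma laurentXD m n : laurentX (m + n) = laurentX m * laurentX n.
Proof.
by apply: laurentP => k; rewrite [RHS]laurent_mulXl /= subr_eq [n + m]addrC.
Qed.

End Laurent.

Section Subshift.
Context (T : pointedType).
Implicit Types (X A B : set (nat -> T)) (F : set (seq T)) (a b c w : seq T).

Definition occurs w (x : nat -> T) :=
  exists i, mkseq (fun j => x (i + j)%N) (size w) = w.

Definition avoiding F : set (nat -> T) :=
  [set x | forall w, F w -> ~ occurs w x].

Definition is_subshift X := exists F, X = avoiding F.

Definition language X : set (seq T) :=
  [set w | w = [::] \/ exists2 x, X x & occurs w x].

(* The concatenation [w x]: past the end of [w], [nth] returns its default. *)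
Definition wcat w (x : nat -> T) : nat -> T :=
  fun n => nth (x (n - size w)%N) w n.

(* [w ^ k] and the sequence [w w w ...]; the latter is junk for [w = [::]]. *)
Definition wexp w k : seq T := flatten (nseq k w).
Definition winf w : nat -> T := fun n => nth point w (n %% size w).

Definition cyl X a b : set (nat -> T) :=
  [set wcat b x | x in [set x | X (wcat a x) /\ X (wcat b x)]].

Definition boolean_algebra_on X (M : set (set (nat -> T))) :=
  [/\ M `<=` [set A | A `<=` X], M set0 & M X] /\
  [/\ forall A B, M A -> M B -> M (A `&` B),
      forall A B, M A -> M B -> M (A `|` B) &
      forall A, M A -> M (X `\` A)].

Definition balg X : set (set (nat -> T)) :=
  smallest (boolean_algebra_on X)
    [set cyl X a b | a in language X & b in language X].

Definition rel_range X A a : set (nat -> T) := [set x | X x /\ A (wcat a x)].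

Definition is_cycle X A a :=
  [/\ language X a, a <> [::], A !=set0, balg X A & A `<=` rel_range X A a].

Definition cycle_without_exit X A a := is_cycle X A a /\ A = [set winf a].

Definition minimal_cycle_without_exit X A a :=
  cycle_without_exit X A a /\
  ~ exists b k, [/\ language X b, (1 <= size b < size a)%N, (2 <= k)%N
                  & a = wexp b k].

Lemma sub_balg X A : balg X A -> A `<=` X.
Proof.
move=> hA; apply: (hA [set B | B `<=` X]); split.
  split; first by split=> // A1 [].
  split=> [A1 A2 hA1 _ x [/hA1 //]|A1 A2 hA1 hA2 x [/hA1 //|/hA2 //]|A1 _ x []//].
by move=> _ [a _ [b _ <-]] _ [x [_ hx] <-].
Qed.

Lemma balg_boolean X : boolean_algebra_on X (balg X).
Proof.
split; split.
- by move=> A; exact: sub_balg.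
- by move=> M [[[]]].
- by move=> M [[[]]].
- by move=> A B hA hB M hM; have [[_ [hI _ _]] _] := hM; apply: hI; [apply: hA|apply: hB].
- by move=> A B hA hB M hM; have [[_ [_ hU _]] _] := hM; apply: hU; [apply: hA|apply: hB].
- by move=> A hA M hM; have [[_ [_ _ hD]] _] := hM; apply: hD; apply: hA.
Qed.

Lemma cyl_balg X a b : language X a -> language X b -> balg X (cyl X a b).
Proof. by move=> ha hb; apply: sub_gen_smallest; exists a => //; exists b. Qed.

Lemma balg0 X : balg X set0. Proof. by have [[]] := balg_boolean X. Qed.
Lemma balgT X : balg X X. Proof. by have [[]] := balg_boolean X. Qed.

End Subshift.

Section WordProducts.
Context (T : Type) (B : pzRingType) (s t : T -> B).

Definition sword (a : seq T) : B := \prod_(x <- a) s x.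

(* If [t x] is the adjoint of [s x], this is the adjoint of [sword a]. *)
Definition sword_star (a : seq T) : B := \prod_(x <- rev a) t x.

Definition sword_zpow (a : seq T) (n : int) : B :=
  match n with
  | Posz k => sword a ^+ k
  | Negz k => sword_star a ^+ k.+1
  end.

End WordProducts.

(* Families [p, s, t] in [B] satisfying the defining relations, [t a] standing
   for [s_a^*].  The index of [p] is a set together with a proof that it belongs
   to the Boolean algebra; by proof irrelevance only the set matters. *)
Record subshift_family (T : pointedType) (X : set (nat -> T)) (B : pzRingType)
    (p : forall A, balg X A -> B) (s t : T -> B) : Prop := SubshiftFamily {
  sf_top : forall hX, p X hX = 1;
  sf_cap : forall A1 A2 h1 h2 h, p (A1 `&` A2) h = p A1 h1 * p A2 h2;
  sf_cup : forall A1 A2 h1 h2 h h',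
    p (A1 `|` A2) h = p A1 h1 + p A2 h2 - p (A1 `&` A2) h';
  sf_bot : forall h, p set0 h = 0;
  sf_sts : forall a, s a * t a * s a = s a;
  sf_tst : forall a, t a * s a * t a = t a;
  sf_cyl : forall (a b : seq T), language X a -> language X b ->
    forall h, sword s b * sword_star t a * sword s a * sword_star t b
              = p (cyl X a b) h
}.

(* The universal algebra is the set of formal expressions in the generators,
   modulo the identities that hold for every family as above in every
   [R]-algebra. *)
Inductive sterm (R : Type) (T : pointedType) (X : set (nat -> T)) :=
  | TProj A of balg X A
  | TGen of T
  | TGenStar of T
  | TZero
  | TOne
  | TAdd of sterm R X & sterm R X
  | TOpp of sterm R X
  | TMul of sterm R X & sterm R X
  | TScale of R & sterm R X.
Arguments TProj {R T X A}.
Arguments TGen {R T X}.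
Arguments TGenStar {R T X}.
Arguments TZero {R T X}.
Arguments TOne {R T X}.

Section SubshiftAlgebra.
Context (R : comPzRingType) (T : pointedType) (X : set (nat -> T)).
Local Notation term := (sterm R X).

Section Eval.
Context (B : pzAlgType R) (p : forall A, balg X A -> B) (s t : T -> B).

Fixpoint seval (u : term) : B :=
  match u with
  | TProj A hA => p hA
  | TGen a => s a
  | TGenStar a => t a
  | TZero => 0
  | TOne => 1
  | TAdd u v => seval u + seval v
  | TOpp u => - seval u
  | TMul u v => seval u * seval v
  | TScale k u => k *: seval u
  end.

End Eval.

Definition sterm_eqv (u v : {classic term}) : bool :=
  `[< forall (B : pzAlgType R) (p : forall A, balg X A -> B) (s t : T -> B),
        subshift_family p s t -> seval p s t u = seval p s t v >].

Fact sterm_eqv_refl : reflexive sterm_eqv.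
Proof. by move=> u; apply/asboolP. Qed.
Fact sterm_eqv_sym : symmetric sterm_eqv.
Proof.
by move=> u v; apply/asboolP/asboolP => h B p s t hf; rewrite (h B p s t hf).
Qed.
Fact sterm_eqv_trans : transitive sterm_eqv.
Proof.
move=> v u w /asboolP h1 /asboolP h2; apply/asboolP => B p s t hf.
by rewrite (h1 B p s t hf) (h2 B p s t hf).
Qed.
Canonical sterm_equiv :=
  EquivRel sterm_eqv sterm_eqv_refl sterm_eqv_sym sterm_eqv_trans.

Definition subshift_alg_raw := {eq_quot sterm_equiv}.
HB.instance Definition _ := Choice.on subshift_alg_raw.

Definition sclass (u : term) : subshift_alg_raw := \pi_({eq_quot sterm_equiv})%qT u.
Definition srepr (x : subshift_alg_raw) : term := repr x.

Definition salg_lift (B : pzAlgType R) (p : forall A, balg X A -> B)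
  (s t : T -> B) (x : subshift_alg_raw) : B := seval p s t (srepr x).

Lemma salg_liftE (B : pzAlgType R) (p : forall A, balg X A -> B) (s t : T -> B) :
  subshift_family p s t -> forall u, salg_lift p s t (sclass u) = seval p s t u.
Proof.
move=> hf u; rewrite /salg_lift /srepr /sclass.
have /eqmodP /asboolP h : (repr (\pi_({eq_quot sterm_equiv})%qT u) =
  u %[mod {eq_quot sterm_equiv}])%qT by rewrite reprK.
exact: (h B p s t hf).
Qed.

Lemma salg_eqP (x y : subshift_alg_raw) :
  (forall (B : pzAlgType R) (p : forall A, balg X A -> B) (s t : T -> B),
     subshift_family p s t -> salg_lift p s t x = salg_lift p s t y) -> x = y.
Proof.
move=> h; rewrite -[x]reprK -[y]reprK; apply/eqmodP/asboolP => B p s t hf.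
exact: (h B p s t hf).
Qed.

Definition salg_add x y := sclass (TAdd (srepr x) (srepr y)).
Definition salg_opp x := sclass (TOpp (srepr x)).
Definition salg_mul x y := sclass (TMul (srepr x) (srepr y)).
Definition salg_scale k x := sclass (TScale k (srepr x)).

Lemma salg_lift_ops (B : pzAlgType R) (p : forall A, balg X A -> B)
    (s t : T -> B) (hf : subshift_family p s t) (l := salg_lift p s t) :
  ((l (sclass TZero) = 0%R) * (l (sclass TOne) = 1%R) *
   (forall x y, l (salg_add x y) = (l x + l y)%R) *
   (forall x, l (salg_opp x) = (- l x)%R) *
   (forall x y, l (salg_mul x y) = (l x * l y)%R) *
   (forall k x, l (salg_scale k x) = (k *: l x)%R))%type.
Proof. by do !split; move=> *; apply: salg_liftE. Qed.

Fact salg_addA : associative salg_add.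
Proof. by move=> x y z; apply: salg_eqP => B p s t /salg_lift_ops E; rewrite !E addrA. Qed.
Fact salg_addC : commutative salg_add.
Proof. by move=> x y; apply: salg_eqP => B p s t /salg_lift_ops E; rewrite !E addrC. Qed.
Fact salg_add0 : left_id (sclass TZero) salg_add.
Proof. by move=> x; apply: salg_eqP => B p s t /salg_lift_ops E; rewrite !E add0r. Qed.
Fact salg_addN : left_inverse (sclass TZero) salg_opp salg_add.
Proof. by move=> x; apply: salg_eqP => B p s t /salg_lift_ops E; rewrite !E addNr. Qed.
HB.instance Definition _ := GRing.isZmodule.Build subshift_alg_raw
  salg_addA salg_addC salg_add0 salg_addN.

Fact salg_mulA : associative salg_mul.
Proof. by move=> x y z; apply: salg_eqP => B p s t /salg_lift_ops E; rewrite !E mulrA. Qed.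
Fact salg_mul1l : left_id (sclass TOne) salg_mul.
Proof. by move=> x; apply: salg_eqP => B p s t /salg_lift_ops E; rewrite !E mul1r. Qed.
Fact salg_mul1r : right_id (sclass TOne) salg_mul.
Proof. by move=> x; apply: salg_eqP => B p s t /salg_lift_ops E; rewrite !E mulr1. Qed.
Fact salg_mulDl : left_distributive salg_mul salg_add.
Proof. by move=> x y z; apply: salg_eqP => B p s t /salg_lift_ops E; rewrite !E mulrDl. Qed.
Fact salg_mulDr : right_distributive salg_mul salg_add.
Proof. by move=> x y z; apply: salg_eqP => B p s t /salg_lift_ops E; rewrite !E mulrDr. Qed.
HB.instance Definition _ := GRing.Zmodule_isPzRing.Build subshift_alg_raw
  salg_mulA salg_mul1l salg_mul1r salg_mulDl salg_mulDr.

Fact salg_scaleA a b x : salg_scale a (salg_scale b x) = salg_scale (a * b) x.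
Proof. by apply: salg_eqP => B p s t /salg_lift_ops E; rewrite !E scalerA. Qed.
Fact salg_scale1 : left_id 1 salg_scale.
Proof. by move=> x; apply: salg_eqP => B p s t /salg_lift_ops E; rewrite !E scale1r. Qed.
Fact salg_scaleDr : right_distributive salg_scale salg_add.
Proof. by move=> k x y; apply: salg_eqP => B p s t /salg_lift_ops E; rewrite !E scalerDr. Qed.
Fact salg_scaleDl x : {morph salg_scale^~ x : a b / a + b >-> salg_add a b}.
Proof. by move=> a b; apply: salg_eqP => B p s t /salg_lift_ops E; rewrite !E scalerDl. Qed.
Fact salg_scaleAl k x y : salg_scale k (salg_mul x y) = salg_mul (salg_scale k x) y.
Proof. by apply: salg_eqP => B p s t /salg_lift_ops E; rewrite !E pzscalerAl. Qed.
Fact salg_scaleAr k x y : salg_scale k (salg_mul x y) = salg_mul x (salg_scale k y).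
Proof. by apply: salg_eqP => B p s t /salg_lift_ops E; rewrite !E pzscalerAr. Qed.

Definition subshift_alg : pzAlgType R :=
  @PzAlgType R subshift_alg_raw salg_scale salg_scaleA salg_scale1 salg_scaleDr
    salg_scaleDl salg_scaleAl salg_scaleAr.

Lemma sclassD u v : sclass (TAdd u v) = (sclass u : subshift_alg) + sclass v.
Proof.
apply: salg_eqP => B p s t hf.
by rewrite (salg_lift_ops hf) !(salg_liftE hf).
Qed.

Lemma sclassN u : sclass (TOpp u) = - (sclass u : subshift_alg).
Proof.
apply: salg_eqP => B p s t hf.
by rewrite (salg_lift_ops hf) !(salg_liftE hf).
Qed.

Lemma sclassM u v : sclass (TMul u v) = (sclass u : subshift_alg) * sclass v.
Proof.
apply: salg_eqP => B p s t hf.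
by rewrite (salg_lift_ops hf) !(salg_liftE hf).
Qed.

Lemma sclassZ k u : sclass (TScale k u) = k *: (sclass u : subshift_alg).
Proof.
apply: salg_eqP => B p s t hf.
by rewrite (salg_lift_ops hf) !(salg_liftE hf).
Qed.

Definition pr A (hA : balg X A) : subshift_alg := sclass (TProj hA).
Definition sgen (a : T) : subshift_alg := sclass (TGen a).
Definition sgen_star (a : T) : subshift_alg := sclass (TGenStar a).

Lemma salg_lift_hom (B : pzAlgType R) (p : forall A, balg X A -> B)
    (s t : T -> B) :
  subshift_family p s t -> alg_hom (salg_lift p s t : subshift_alg -> B).
Proof.
move=> /salg_lift_ops E; split=> [k x y|]; first by rewrite !E.
by split=> [|x y]; rewrite E.
Qed.

Lemma subshift_alg_family : subshift_family pr sgen sgen_star.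
Proof.
split=> *; apply: salg_eqP => B p s t hf; have hl := salg_lift_hom hf.
- by rewrite (alg_hom1 hl) (salg_liftE hf) /= (sf_top hf).
- by rewrite (alg_homM hl) !(salg_liftE hf) /=; apply: (sf_cap hf).
- rewrite (alg_homD hl) (alg_homN hl) (alg_homD hl) !(salg_liftE hf) /=.
  exact: (sf_cup hf).
- by rewrite (alg_hom0 hl) (salg_liftE hf) /= (sf_bot hf).
- by rewrite !(alg_homM hl) !(salg_liftE hf) /= (sf_sts hf).
- by rewrite !(alg_homM hl) !(salg_liftE hf) /= (sf_tst hf).
rewrite !(alg_homM hl) !(alg_hom_prod hl) (salg_liftE hf) /=.
have Es u : \prod_(i <- u) salg_lift p s t (sgen i) = \prod_(i <- u) s i.
  by apply: eq_bigr => i _; exact: salg_liftE.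
have Et u : \prod_(i <- u) salg_lift p s t (sgen_star i) = \prod_(i <- u) t i.
  by apply: eq_bigr => i _; exact: salg_liftE.
by rewrite !Es !Et; exact: (sf_cyl hf).
Qed.

Theorem subshift_alg_universal (B : pzAlgType R)
    (p : forall A, balg X A -> B) (s t : T -> B) :
  subshift_family p s t ->
  exists! f : subshift_alg -> B,
    [/\ alg_hom f, forall A (hA : balg X A), f (pr hA) = p A hA,
        forall a, f (sgen a) = s a & forall a, f (sgen_star a) = t a].
Proof.
move=> hf; exists (salg_lift p s t); split.
  split; [exact: salg_lift_hom | | |] => *; exact: (salg_liftE hf).
move=> f [hhom hp hs ht]; apply/funext => x; rewrite /salg_lift.
rewrite -[in RHS](reprK x) -/(srepr x) -/(sclass _).
elim: (srepr x) => /=.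
- by move=> A hA; rewrite -hp.
- by move=> a; rewrite -hs.
- by move=> a; rewrite -ht.
- exact: (esym (alg_hom0 hhom)).
- exact: (esym (alg_hom1 hhom)).
- by move=> u -> v ->; rewrite -(alg_homD hhom) sclassD.
- by move=> u ->; rewrite -(alg_homN hhom) sclassN.
- by move=> u -> v ->; rewrite -(alg_homM hhom) sclassM.
- by move=> k u ->; rewrite -(alg_homZ hhom) sclassZ.
Qed.

Lemma pr_idem A (hA : balg X A) : pr hA * pr hA = pr hA.
Proof.
apply: salg_eqP => B p s t hf; rewrite (alg_homM (salg_lift_hom hf)).
rewrite !(salg_liftE hf) /=; have hAA : balg X (A `&` A) by rewrite setIid.
rewrite -(sf_cap hf hA hA hAA); move: hAA; rewrite setIid => hA'.
by congr p; exact: Prop_irrelevance.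
Qed.

End SubshiftAlgebra.
Arguments sgen {R T X}.
Arguments sgen_star {R T X}.
Arguments pr R {T X A}.
Arguments pr_idem R {T X A}.

(* Main.v *)
(* Write z = c^oo and e = p_{{z}}.  For every A in the Boolean algebra and every
   letter a, p_A s_a = s_a p_{r(A,a)} and s_a^* p_A = p_{r(A,a)} s_a^*; hence
   s_(z_0..z_(j-1))^* e = p_{{shift^j z}} s_(z_0..z_(j-1))^*, and the left ideal
   generated by e is spanned by the s_a s_(z_0..z_(j-1))^* e.  Multiplying by e
   on the left kills such an element unless a is a prefix of z and
   shift^|a| z = shift^j z; by minimality of c the latter means |a| = j mod |c|,
   and the element is then a power of s_c times e.  So the corner is spanned by
   the s_c^n e, which multiply like the x^n.  They are linearly independent
   because the algebra acts on the functions X x Z -> R, with s_a raising the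
   second coordinate by one, and s_c^n e sends the indicator function of (z, 0)
   to that of (z, n |c|). *)
Require Import Defs.
From HB Require Import structures.
From mathcomp Require Import all_boot all_order all_algebra.
From mathcomp Require Import finmap.
From mathcomp Require Import boolp classical_sets functions.

Set Implicit Arguments.
Unset Strict Implicit.
Unset Printing Implicit Defensive.

Import GRing.Theory.
Local Open Scope classical_set_scope.
Local Open Scope ring_scope.

(** * Words and shifts *)

Section Words.
Local Open Scope nat_scope.
Context (T : pointedType).
Implicit Types (X : set (nat -> T)) (a b c : seq T) (x y : nat -> T).

Definition shift i x : nat -> T := fun n => x (i + n).

Lemma shiftD i j x : shift i (shift j x) = shift (j + i) x.
Proof. by apply/funext => n; rewrite /shift addnA. Qed.

Lemma wcat0 x : wcat [::] x = x.
Proof. by apply/funext => n; rewrite /wcat subn0 nth_nil. Qed.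

Lemma wcat_cat a b x : wcat (a ++ b) x = wcat a (wcat b x).
Proof.
apply/funext => n; rewrite /wcat nth_cat size_cat.
case: ltnP => hn; last by rewrite subnDA [RHS]nth_default.
exact: set_nth_default.
Qed.

Lemma wcat_cons i a x : wcat (i :: a) x = wcat [:: i] (wcat a x).
Proof. by rewrite -wcat_cat. Qed.

Lemma shift_wcat a x : shift (size a) (wcat a x) = x.
Proof.
apply/funext => n; rewrite /shift /wcat nth_default ?leq_addr //.
by rewrite addKn.
Qed.

Lemma mkseq_wcat a x : mkseq (wcat a x) (size a) = a.
Proof.
apply: (@eq_from_nth _ point); rewrite size_mkseq // => i hi.
by rewrite nth_mkseq // /wcat; exact: set_nth_default.
Qed.

Lemma wcat_mkseq x i : wcat (mkseq x i) (shift i x) = x.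
Proof.
apply/funext => n; rewrite /wcat /shift size_mkseq.
case: (ltnP n i) => hn; first by rewrite nth_mkseq.
by rewrite nth_default ?size_mkseq // subnKC.
Qed.

Lemma wcat_eq a x y :
  wcat a x = y <-> a = mkseq y (size a) /\ x = shift (size a) y.
Proof.
split=> [<-|[ha ->]]; first by rewrite mkseq_wcat shift_wcat.
by rewrite {1}ha wcat_mkseq.
Qed.

Lemma wcat_inj a : injective (wcat a).
Proof. by move=> x y /(congr1 (shift (size a))); rewrite !shift_wcat. Qed.

Lemma mkseqD x i j : mkseq x (i + j) = mkseq x i ++ mkseq (shift i x) j.
Proof.
rewrite /mkseq iotaD map_cat add0n -{2}[i]addn0 iotaDl -map_comp.
by [].
Qed.

Lemma mkseqS x i : mkseq x i.+1 = rcons (mkseq x i) (x i).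
Proof. by rewrite -addn1 mkseqD cats1 /= /shift addn0. Qed.

Lemma subshift_shift X i x : is_subshift X -> X x -> X (shift i x).
Proof.
move=> [F ->] hx w /hx hw [j hj]; apply: hw; exists (i + j).
by rewrite -[RHS]hj; apply: eq_mkseq => k; rewrite /shift addnA.
Qed.

Lemma subshift_wcat X a x : is_subshift X -> X (wcat a x) -> X x.
Proof. by move=> sX /(subshift_shift (size a) sX); rewrite shift_wcat. Qed.

Lemma language_wcat X a x : X (wcat a x) -> language X a.
Proof.
by move=> hx; right; exists (wcat a x) => //; exists 0; exact: mkseq_wcat.
Qed.

(** A word occurring at position [i] starts the sequence shifted by [i], which is still in [X].
    Nonemptiness of [X] covers the empty word. *)
Lemma languageP X a : is_subshift X -> X !=set0 ->
  language X a -> exists x, X (wcat a x).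
Proof.
move=> sX [y hy] [->|[x hx [i hi]]]; first by exists y; rewrite wcat0.
exists (shift (i + size a) x); have := subshift_shift i sX hx.
congr X; apply/esym/wcat_eq; split; first exact: esym hi.
by rewrite shiftD.
Qed.

Lemma language_cat X a b : is_subshift X -> X !=set0 ->
  language X (a ++ b) -> language X a /\ language X b.
Proof.
move=> sX X0 /(languageP sX X0)[x]; rewrite wcat_cat => hx.
by split; [exact: language_wcat hx|exact: language_wcat (subshift_wcat sX hx)].
Qed.

Lemma wcat_winf c : c <> [::] -> wcat c (winf c) = winf c.
Proof.
move=> c0; have sc : 0 < size c by case: c c0.
apply/wcat_eq; split.
  apply: (@eq_from_nth _ point); rewrite ?size_mkseq // => i hi.
  by rewrite nth_mkseq // /winf modn_small.
by apply/funext => n; rewrite /shift /winf modnDl.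
Qed.

Lemma shift_winf c k : c <> [::] -> shift (k * size c) (winf c) = winf c.
Proof.
move=> c0; elim: k => // k IH.
by rewrite mulSn -shiftD -{1}(wcat_winf c0) shift_wcat IH.
Qed.

(* The shift periods of a sequence are closed under differences, hence under
   gcd. *)
Lemma shift_gcd x i j : 0 < i ->
  shift i x = x -> shift j x = x -> shift (gcdn i j) x = x.
Proof.
move=> i0 hi hj; have hm k l : shift k x = x -> shift (l * k) x = x.
  by move=> hk; elim: l => // l IH; rewrite mulSn -shiftD hk IH.
case: (egcdnP j i0) => u v E _.
by rewrite -{1}(hm j v hj) shiftD -E hm.
Qed.

Lemma wexp_mkseq x g k : shift g x = x -> mkseq x (k * g) = wexp (mkseq x g) k.
Proof.
move=> hg; elim: k => // k IH.
by rewrite mulSn mkseqD hg IH.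
Qed.

(** Equal shifts make [d] a period of [winf c], hence also the gcd [g] of [size c] and [d]. If [g]
    were smaller than [size c], the word [c] would be a proper power of its prefix of length [g],
    against minimality. *)
Lemma minimal_shift_inj X A c i d : is_subshift X ->
    minimal_cycle_without_exit X A c ->
  shift i (winf c) = shift (i + d) (winf c) -> size c %| d.
Proof.
move=> sX [[[Lc c0 A0 hA AA] AE] hmin] E.
have [N0 X0] : 0 < size c /\ X !=set0.
  by split; [case: (c) c0|case: A0 => x /AA[? _]; exists x].
(* Shifting both sides of [E] by a further [i * size c - i] places completes [i] turns of the cycle
   and leaves only the shift by [d]. *)
have hd : shift d (winf c) = winf c.
  have hN : i <= i * size c by rewrite leq_pmulr.
  rewrite -{2}(shift_winf i c0) -(subnKC hN) -shiftD E shiftD addnAC subnKC //.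
  by rewrite -shiftD shift_winf.
have hN : shift (size c) (winf c) = winf c.
  by rewrite -{1}[size c]mul1n shift_winf.
have hg := shift_gcd N0 hN hd; set g := gcdn _ _ in hg.
apply/gcdn_idPl; rewrite -/g; apply: contra_notP hmin => gN.
have gdv : g %| size c by exact: dvdn_gcdl.
have cE : c = mkseq (winf c) (size c).
  by have /wcat_eq[] := wcat_winf c0.
have g0 : 0 < g by rewrite gcdn_gt0 N0.
have gl : g < size c by rewrite ltn_neqAle (introN eqP gN) dvdn_leq.
exists (mkseq (winf c) g), (size c %/ g); split.
- move: Lc; rewrite {1}cE -(subnKC (ltnW gl)) mkseqD.
  by move=> /(language_cat sX X0)[].
- by rewrite size_mkseq g0 gl.
- by rewrite ltn_divRL ?mul1n.
- by rewrite -wexp_mkseq // (divnK gdv).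
Qed.

End Words.

(** * Relations in a subshift family *)

Section Family.
Context (T : pointedType) (X : set (nat -> T)) (B : pzRingType).
Context (p : forall A, balg X A -> B) (s t : T -> B).
Hypotheses (sX : is_subshift X) (X_letters : forall i : T, language X [:: i]).
Hypothesis hf : subshift_family p s t.
Implicit Types (A : set (nat -> T)) (a b : seq T) (i j : T) (x : nat -> T).

(* Junk value [0] outside of the Boolean algebra. *)
Definition tproj A : B := if pselect (balg X A) is left h then p h else 0.

Lemma tprojE A (h : balg X A) : p h = tproj A.
Proof.
rewrite /tproj; case: pselect => // h'; congr p; exact: Prop_irrelevance.
Qed.

Lemma balgI A1 A2 : balg X A1 -> balg X A2 -> balg X (A1 `&` A2).
Proof. by have [_ [h _ _]] := balg_boolean X; exact: h. Qed.

Lemma balgU A1 A2 : balg X A1 -> balg X A2 -> balg X (A1 `|` A2).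
Proof. by have [_ [_ h _]] := balg_boolean X; exact: h. Qed.

Lemma balgD A : balg X A -> balg X (X `\` A).
Proof. by have [_ [_ _ h]] := balg_boolean X; exact: h. Qed.

Lemma tproj0 : tproj set0 = 0.
Proof. by rewrite -(tprojE (@balg0 _ X)) (sf_bot hf). Qed.

Lemma tprojT : tproj X = 1.
Proof. by rewrite -(tprojE (@balgT _ X)) (sf_top hf). Qed.

Lemma tprojI A1 A2 : balg X A1 -> balg X A2 ->
  tproj (A1 `&` A2) = tproj A1 * tproj A2.
Proof.
by move=> h1 h2; rewrite -(tprojE (balgI h1 h2)) (sf_cap hf h1 h2) !tprojE.
Qed.

Lemma tprojU A1 A2 : balg X A1 -> balg X A2 ->
  tproj (A1 `|` A2) = tproj A1 + tproj A2 - tproj A1 * tproj A2.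
Proof.
move=> h1 h2; rewrite -(tprojE (balgU h1 h2)) (sf_cup hf h1 h2 _ (balgI h1 h2)).
by rewrite !tprojE tprojI.
Qed.

Lemma tprojD A : balg X A -> tproj (X `\` A) = 1 - tproj A.
Proof.
move=> h; have := tprojU h (balgD h).
rewrite -tprojI //; last exact: balgD.
have -> : A `&` (X `\` A) = set0 by rewrite setDE setIA setIAC setICr set0I.
rewrite setDE setUIr setUv setIT (setUidr (sub_balg h)) tprojT tproj0 subr0.
by move=> ->; rewrite addrC addKr.
Qed.

Lemma tprojC A1 A2 : balg X A1 -> balg X A2 ->
  tproj A1 * tproj A2 = tproj A2 * tproj A1.
Proof. by move=> h1 h2; rewrite -!tprojI // setIC. Qed.

Lemma tproj_cyl a b : language X a -> language X b ->
  sword s b * sword_star t a * sword s a * sword_star t b = tproj (cyl X a b).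
Proof.
by move=> ha hb; rewrite (sf_cyl hf ha hb (cyl_balg ha hb)) tprojE.
Qed.

Lemma sword_nil : sword s [::] = 1. Proof. exact: big_nil. Qed.
Lemma sword_star_nil : sword_star t [::] = 1. Proof. exact: big_nil. Qed.

Lemma sword_cat a b : sword s (a ++ b) = sword s a * sword s b.
Proof. exact: big_cat. Qed.

Lemma sword_star_cat a b :
  sword_star t (a ++ b) = sword_star t b * sword_star t a.
Proof. by rewrite /sword_star rev_cat; exact: big_cat. Qed.

Lemma sword1 i : sword s [:: i] = s i. Proof. exact: big_seq1. Qed.
Lemma sword_star1 i : sword_star t [:: i] = t i. Proof. exact: big_seq1. Qed.

Lemma sword_cons i a : sword s (i :: a) = s i * sword s a.
Proof. exact: big_cons. Qed.

Lemma sword_star_cons i a : sword_star t (i :: a) = sword_star t a * t i.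
Proof. by rewrite -sword_star1 -sword_star_cat. Qed.

Let nilX : language X [::]. Proof. by left. Qed.

Lemma tproj_range a : language X a ->
  sword s a * sword_star t a = tproj (cyl X [::] a).
Proof. by move=> ha; rewrite -tproj_cyl // sword_nil sword_star_nil !mulr1. Qed.

Lemma tproj_source a : language X a ->
  sword_star t a * sword s a = tproj (cyl X a [::]).
Proof.
by move=> ha; rewrite -tproj_cyl // sword_nil sword_star_nil mulr1 mul1r.
Qed.

Lemma cylP a b x : cyl X a b x <->
  exists y, [/\ x = wcat b y, X (wcat a y) & X (wcat b y)].
Proof. by split=> [[y [? ?] <-]|[y [-> ? ?]]]; exists y. Qed.

Lemma cyl_range a : cyl X [::] a = [set wcat a x | x in [set x | X (wcat a x)]].
Proof.
apply/seteqP; split=> x [y hy <-]; exists y => //; first exact: hy.2.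
by split=> //; rewrite wcat0; apply: subshift_wcat hy.
Qed.

Lemma letter_range i : s i * t i = tproj (cyl X [::] [:: i]).
Proof. by rewrite -tproj_range // sword1 sword_star1. Qed.

Lemma letter_source i : t i * s i = tproj (cyl X [:: i] [::]).
Proof. by rewrite -tproj_source // sword1 sword_star1. Qed.

Lemma balg_letter i : balg X (cyl X [::] [:: i]).
Proof. exact: cyl_balg. Qed.

(** Inserting [s i * t i] and [s j * t j] in the middle exposes the projections of two disjoint
    sets, the sequences beginning with [i] and with [j]. *)
Lemma letter_orth i j : i <> j -> t i * s j = 0.
Proof.
move=> ij; rewrite -(sf_tst hf i) -(sf_sts hf j) !mulrA -(mulrA (t i)).
rewrite -(mulrA _ (s j)) -(mulrA _ (s i * t i)) !letter_range.
rewrite -tprojI; try exact: balg_letter.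
rewrite (_ : _ `&` _ = set0) ?tproj0 ?mulr0 ?mul0r //.
apply/seteqP; split=> // x []; rewrite !cyl_range => -[y _ <-] [y' _].
by move=> /(congr1 (@^~ 0%N)); rewrite /wcat /= => /esym.
Qed.

(** These relations are stable under Boolean operations, so they can be proved by induction over the
    generated algebra. Membership of the range comes along because [tproj] is meaningful only inside
    the algebra. *)
Definition transports i A := [/\ balg X (rel_range X A [:: i]),
  tproj A * s i = s i * tproj (rel_range X A [:: i]) &
  t i * tproj A = tproj (rel_range X A [:: i]) * t i].

Lemma rel_range0 a : rel_range X set0 a = set0.
Proof. by apply/seteqP; split=> // x []. Qed.

Lemma rel_rangeT i : rel_range X X [:: i] = cyl X [:: i] [::].
Proof.
apply/seteqP; split=> x.
  by case=> ? ?; apply/cylP; exists x; rewrite wcat0.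
by case=> y [h]; rewrite wcat0 => ? <-.
Qed.

Lemma letter_sourcer i : s i * tproj (cyl X [:: i] [::]) = s i.
Proof. by rewrite -letter_source mulrA (sf_sts hf). Qed.

Lemma letter_sourcel i : tproj (cyl X [:: i] [::]) * t i = t i.
Proof. by rewrite -letter_source (sf_tst hf). Qed.

(** No sequence of [A] begins with [i], so [tproj A] annihilates [s i * t i], which can be inserted
    next to [s i] or [t i]. *)
Lemma transports_empty i A : balg X A -> rel_range X A [:: i] = set0 ->
  transports i A.
Proof.
move=> hA r0; have AZ : A `&` cyl X [::] [:: i] = set0.
  apply/seteqP; split=> // x [Ax]; rewrite cyl_range => -[y hy xE].
  have : rel_range X A [:: i] y by split; [exact: subshift_wcat hy|rewrite xE].
  by rewrite r0.
have AZ0 : tproj A * tproj (cyl X [::] [:: i]) = 0.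
  by rewrite -tprojI // ?AZ ?tproj0 //; exact: balg_letter.
split; rewrite r0 ?tproj0 ?mulr0 ?mul0r; first exact: balg0.
  by rewrite -(sf_sts hf i) letter_range mulrA AZ0 mul0r.
rewrite -(sf_tst hf i) -!mulrA (mulrA (s i)) letter_range -tprojC //.
  by rewrite AZ0 mulr0.
exact: balg_letter.
Qed.

Lemma transports_cyl i a b :
  language X a -> language X b -> transports i (cyl X a b).
Proof.
move=> ha hb; have X0 : X !=set0.
  by have [//|[x hx _]] := X_letters i; exists x.
have hC := cyl_balg ha hb; have hZ := balg_letter i.
(* For empty [b] the range consists of the [x] with [a i x] in [X], again a cylinder unless the word
   [a i] leaves the language. If [b] has first letter [j], only [i = j] can give a nonempty
   range. *)
case: b => [|j b] in hb hC *.
  have rE : rel_range X (cyl X a [::]) [:: i] =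
      [set x | X (wcat (a ++ [:: i]) x)].
    apply/seteqP; split=> x.
      case=> hx /cylP[y []]; rewrite wcat0 => xE hy _.
      by rewrite /= wcat_cat xE.
    rewrite /= wcat_cat => hx; have hix := subshift_wcat sX hx.
    split; first exact: subshift_wcat hix.
    by apply/cylP; exists (wcat [:: i] x); rewrite !wcat0.
  have [hai|hai] := pselect (language X (a ++ [:: i])); last first.
    apply: transports_empty => //; rewrite rE; apply/seteqP; split=> // x hx.
    exact/hai/(language_wcat hx).
  have {}rE : rel_range X (cyl X a [::]) [:: i] = cyl X (a ++ [:: i]) [::].
    rewrite rE; apply/seteqP; split=> x.
      move=> hx; apply/cylP; exists x; split; rewrite ?wcat0 //.
      by move: hx; rewrite /= wcat_cat => /(subshift_wcat sX)/(subshift_wcat sX).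
    by case/cylP=> y [-> hy _]; rewrite wcat0.
  have CE : tproj (cyl X (a ++ [:: i]) [::]) = t i * tproj (cyl X a [::]) * s i.
    rewrite -!tproj_source // sword_cat sword_star_cat sword1 sword_star1.
    by rewrite !mulrA.
  split; rewrite rE ?CE; first exact: cyl_balg.
    by rewrite !mulrA letter_range -tprojC // -mulrA -letter_range (sf_sts hf).
  rewrite -(mulrA _ (s i)) letter_range -mulrA tprojC // mulrA -letter_range.
  by rewrite mulrA (sf_tst hf).
have [_ hb'] := @language_cat _ X [:: j] b sX X0 hb.
have [<-{i hZ}|ij] := pselect (j = i); last first.
  apply: transports_empty => //; apply/seteqP; split=> // x [_ /cylP[y [+ _ _]]].
  by move=> /(congr1 (@^~ 0%N)); rewrite /wcat /= => /esym.
have hC' := cyl_balg ha hb'.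
have hS : balg X (cyl X [:: j] [::]) by exact: cyl_balg.
(* Membership of [x] in [cyl X a b] does not say that [j x] lies in [X]; the second factor restores
   this. *)
have rE : rel_range X (cyl X a (j :: b)) [:: j] =
    cyl X a b `&` cyl X [:: j] [::].
  apply/seteqP; split=> x.
    case=> hx /cylP[y []]; rewrite (wcat_cons j b) => /wcat_inj -> hy hy'.
    split; apply/cylP; first by exists y; split=> //; apply: subshift_wcat hy'.
    by exists (wcat b y); rewrite wcat0; split=> //; apply: subshift_wcat hy'.
  case=> /cylP[y [-> hy hy']] /cylP[z []]; rewrite wcat0 => <- hz _.
  by split=> //; apply/cylP; exists y; rewrite (wcat_cons j b).
have CE : tproj (cyl X a (j :: b)) = s j * tproj (cyl X a b) * t j.
  by rewrite -!tproj_cyl // sword_cons sword_star_cons !mulrA.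
split; rewrite rE ?tprojI ?CE //; first exact: balgI.
  by rewrite -!mulrA letter_source.
by rewrite !mulrA letter_source tprojC.
Qed.

Lemma transports_balg i A : balg X A -> transports i A.
Proof.
move=> hA; suff [] : balg X A /\ transports i A by [].
(* The transported sets form a Boolean algebra containing the cylinders. Membership in [balg X] is
   carried along because the relations for [tproj] need it. *)
apply: (hA [set A | balg X A /\ transports i A]); split; last first.
  by move=> _ [a ha [b hb <-]]; split; [exact: cyl_balg|exact: transports_cyl].
split; split.
- by move=> A1 [/sub_balg].
- split; first exact: balg0.
  split; rewrite rel_range0 ?tproj0 ?mulr0 ?mul0r //; exact: balg0.
- split; first exact: balgT.
  split; rewrite rel_rangeT ?tprojT; first exact: cyl_balg.
    by rewrite mul1r letter_sourcer.
  by rewrite mulr1 letter_sourcel.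
- move=> A1 A2 [b1 [c1 d1 e1]] [b2 [c2 d2 e2]]; split; first exact: balgI.
  have E : rel_range X (A1 `&` A2) [:: i] =
      rel_range X A1 [:: i] `&` rel_range X A2 [:: i].
    apply/seteqP; split=> x; first by case=> ? [? ?]; do !split.
    by case=> -[? ?] [? ?]; do !split.
  split; rewrite E; first exact: balgI.
    rewrite (tprojI b1 b2) (tprojI c1 c2).
    by rewrite -mulrA d2 mulrA d1 mulrA.
  by rewrite (tprojI b1 b2) (tprojI c1 c2) mulrA e1 -mulrA e2 mulrA.
- move=> A1 A2 [b1 [c1 d1 e1]] [b2 [c2 d2 e2]]; split; first exact: balgU.
  have E : rel_range X (A1 `|` A2) [:: i] =
      rel_range X A1 [:: i] `|` rel_range X A2 [:: i].
    apply/seteqP; split=> x; first by case=> ? []; [left|right].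
    by case=> -[? ?]; split=> //; [left|right].
  split; rewrite E; first exact: balgU.
    rewrite (tprojU b1 b2) (tprojU c1 c2).
    by rewrite mulrBl mulrBr mulrDl mulrDr -(mulrA _ _ (s i)) d2 mulrA d1 mulrA.
  rewrite (tprojU b1 b2) (tprojU c1 c2).
  by rewrite mulrBl mulrBr mulrDl mulrDr (mulrA (t i)) e1 e2 -!mulrA e2.
move=> A1 [b1 [c1 d1 e1]]; split; first exact: balgD.
(* Prepending [i] may leave [X], so the range of a complement is a complement relative to [cyl X
   [:: i] [::]]. *)
have E : rel_range X (X `\` A1) [:: i] =
    cyl X [:: i] [::] `&` (X `\` rel_range X A1 [:: i]).
  rewrite -rel_rangeT; apply/seteqP; split=> x.
    by case=> ? [? h]; split=> //; split=> // -[_ /h].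
  by case=> -[? ?] [_ h]; split=> //; split=> // h'; apply: h.
have hS : balg X (cyl X [:: i] [::]) by exact: cyl_balg.
have hD := balgD c1; split; rewrite E; first exact: balgI.
  rewrite (tprojI hS hD) (tprojD b1) (tprojD c1) mulrA letter_sourcer.
  by rewrite mulrBl mulrBr mul1r mulr1 d1.
rewrite (tprojI hS hD) (tprojC hS hD) -mulrA letter_sourcel.
by rewrite (tprojD b1) (tprojD c1) mulrBl mulrBr mul1r mulr1 e1.
Qed.

Lemma rel_range_nil A : A `<=` X -> rel_range X A [::] = A.
Proof.
move=> AX; apply/seteqP; split=> x; first by case=> _; rewrite wcat0.
by move=> Ax; split; [exact: AX|rewrite wcat0].
Qed.

Lemma rel_range_cons A i a : A `<=` X ->
  rel_range X A (i :: a) = rel_range X (rel_range X A [:: i]) a.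
Proof.
move=> AX; apply/seteqP; split=> x.
  case=> hx; rewrite wcat_cons => h; do !split=> //.
  exact: subshift_wcat (AX _ h).
by case=> hx [_ h]; split=> //; rewrite wcat_cons.
Qed.

Lemma tproj_word a A : balg X A ->
  [/\ balg X (rel_range X A a),
      tproj A * sword s a = sword s a * tproj (rel_range X A a) &
      sword_star t a * tproj A = tproj (rel_range X A a) * sword_star t a].
Proof.
elim: a A => [|i a IH] A hA.
  rewrite rel_range_nil; last exact: sub_balg.
  by rewrite sword_nil sword_star_nil !mulr1 !mul1r.
have [hA1 sA tA] := transports_balg i hA; have [hA2 sA2 tA2] := IH _ hA1.
rewrite rel_range_cons; last exact: sub_balg.
split=> //; first by rewrite sword_cons mulrA sA -!mulrA sA2.
by rewrite sword_star_cons -mulrA tA mulrA tA2 mulrA.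
Qed.

(** A singleton is an atom of the Boolean algebra: it lies inside [A] or is disjoint from it. *)
Lemma tproj_point A x : balg X A -> balg X [set x] ->
  tproj A * tproj [set x] = if x \in A then tproj [set x] else 0.
Proof.
move=> hA hx; rewrite -tprojI //; case: ifPn => xA.
  by rewrite setIidr // => _ ->; exact: set_mem.
rewrite (_ : A `&` _ = set0) ?tproj0 //.
by apply/seteqP; split=> // y [Ay yx]; move: xA; rewrite notin_setE -yx.
Qed.

Lemma rel_range_point x a : X x -> rel_range X [set x] a =
  if a == mkseq x (size a) then [set shift (size a) x] else set0.
Proof.
move=> hx; apply/seteqP; split=> y.
  by case=> hy /wcat_eq[<- ->]; rewrite eqxx.
case: eqP => // aE ->; split; first exact: subshift_shift.
by apply/wcat_eq.
Qed.

End Family.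

(** * Powers of the cycle word and the corner at its periodic point *)

Section Cycle.
Context (T : pointedType) (X : set (nat -> T)) (B : pzRingType).
Context (p : forall A, balg X A -> B) (s t : T -> B).
Hypotheses (sX : is_subshift X) (X_letters : forall i : T, language X [:: i]).
Hypothesis hf : subshift_family p s t.
Context (c : seq T).
Hypothesis c_cycle : minimal_cycle_without_exit X [set winf c] c.
Implicit Types (a b : seq T) (i : T) (j k : nat).

Local Notation z := (winf c).
Local Notation P := (tproj p).
Local Notation e := (P [set z]).
Local Notation zw := (mkseq z).

Let c0 : c <> [::]. Proof. by have [[[]]] := c_cycle. Qed.
Let hz : balg X [set z]. Proof. by have [[[]]] := c_cycle. Qed.
Let Xz : X z. Proof. exact: (sub_balg hz). Qed.

Lemma wcat_zw j : wcat (zw j) (shift j z) = z.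
Proof. exact: wcat_mkseq. Qed.

Lemma language_zw j : language X (zw j).
Proof. by apply: (@language_wcat _ X _ (shift j z)); rewrite wcat_zw. Qed.

Lemma rel_range_zw j : rel_range X [set z] (zw j) = [set shift j z].
Proof. by rewrite rel_range_point // size_mkseq eqxx. Qed.

(** This singleton is the relative range of the point [z] along a prefix of [z], and relative ranges
    stay in the algebra. *)
Lemma balg_shift j : balg X [set shift j z].
Proof.
rewrite -rel_range_zw.
by have [] := tproj_word sX X_letters hf (zw j) hz.
Qed.

Lemma star_point j :
  sword_star t (zw j) * e = P [set shift j z] * sword_star t (zw j).
Proof.
by have [_ _] := tproj_word sX X_letters hf (zw j) hz; rewrite rel_range_zw.
Qed.

Lemma zw_size k j : zw (k * size c + j) = zw (k * size c) ++ zw j.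
Proof. by rewrite mkseqD shift_winf. Qed.

Lemma zwc : zw (size c) = c.
Proof. by have /wcat_eq[] := wcat_winf c0. Qed.

Lemma sword_zw k : sword s (zw (k * size c)) = sword s c ^+ k.
Proof.
elim: k => [|k IH]; first by rewrite sword_nil expr0.
(* Writing the first [size c] as [1 * size c] lets [zw_size] split off one turn of the cycle. *)
rewrite mulSn -[in X in (X + _)%N](mul1n (size c)) zw_size sword_cat IH.
by rewrite mul1n zwc exprS.
Qed.

Lemma sword_star_zw k : sword_star t (zw (k * size c)) = sword_star t c ^+ k.
Proof.
elim: k => [|k IH]; first by rewrite sword_star_nil expr0.
rewrite mulSn -[in X in (X + _)%N](mul1n (size c)) zw_size sword_star_cat IH.
by rewrite mul1n zwc exprSr.
Qed.

Lemma point_range j : sword s (zw j) * sword_star t (zw j) * e = e.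
Proof.
rewrite (tproj_range hf (language_zw j)) (tproj_point hf) //; last first.
  by apply: cyl_balg; [left|exact: language_zw].
rewrite mem_set // cyl_range //; exists (shift j z); rewrite ?wcat_zw //.
by rewrite /= wcat_zw.
Qed.

Lemma shift_c : shift (size c) z = z.
Proof. by have := shift_winf 1 c0; rewrite mul1n. Qed.

(** Removing [c] from the front of [z] gives [z] back, so the relative range along [c] of the point
    [z] is that same point. *)
Lemma point_s : e * sword s c = sword s c * e.
Proof.
have [_ -> _] := tproj_word sX X_letters hf c hz.
by rewrite rel_range_point // zwc eqxx shift_c.
Qed.

Lemma point_t : e * sword_star t c = sword_star t c * e.
Proof. by have := star_point (size c); rewrite zwc shift_c. Qed.

Lemma point_sX k : sword s c ^+ k * e = e * sword s c ^+ k.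
Proof. exact/esym/commrX/point_s. Qed.

Lemma point_tX k : sword_star t c ^+ k * e = e * sword_star t c ^+ k.
Proof. exact/esym/commrX/point_t. Qed.

Lemma zpow_point n : e * sword_zpow s t c n = sword_zpow s t c n * e.
Proof. by case: n => n; [rewrite /= point_sX|rewrite /= point_tX]. Qed.

Lemma ts_point : sword_star t c * sword s c * e = e.
Proof.
have Lc : language X c by rewrite -zwc; exact: language_zw.
rewrite (tproj_source hf Lc) (tproj_point hf) //; last first.
  by apply: cyl_balg => //; left.
by rewrite mem_set //; apply/cylP; exists z; rewrite wcat0 wcat_winf.
Qed.

Lemma st_point : sword s c * sword_star t c * e = e.
Proof. by have := point_range (size c); rewrite zwc. Qed.

Definition zpoint n := sword_zpow s t c n * e.

Lemma zpoint_idem n : e * zpoint n = zpoint n.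
Proof. by rewrite /zpoint mulrA zpow_point -mulrA -(tprojI hf) ?setIid. Qed.

Lemma sword_zpowN k : sword_zpow s t c (- k%:Z) = sword_star t c ^+ k.
Proof. by case: k => // ; rewrite oppr0 !expr0. Qed.

Lemma zpoint_s n : sword s c * zpoint n = zpoint (n + 1).
Proof.
rewrite /zpoint mulrA; case: n => [n|n]; first by rewrite addrC -intS /= exprS.
have -> : Negz n + 1 = - n%:Z by rewrite NegzE intS opprD addrAC addNr add0r.
(* Moving [e] left places it beside [sword s c * sword_star t c], where [st_point] cancels the
   pair. *)
rewrite sword_zpowN /= exprS -!mulrA point_tX.
by rewrite !mulrA st_point.
Qed.

Lemma zpoint_t n : sword_star t c * zpoint n = zpoint (n - 1).
Proof.
rewrite /zpoint mulrA; case: n => [[|n]|n].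
- by rewrite sub0r /= expr0 mulr1 expr1.
- rewrite intS addrAC subrr add0r /= exprS -!mulrA point_sX.
  by rewrite !mulrA ts_point.
have -> : Negz n - 1 = - n.+2%:Z by rewrite NegzE (intS n.+1) opprD addrC.
by rewrite sword_zpowN /= -exprS.
Qed.

(** The right factor absorbs [e]; induction on the first exponent then multiplies by [sword s c] or
    its adjoint, each of which moves the other exponent by one. *)
Lemma zpointM m n : zpoint m * zpoint n = zpoint (m + n).
Proof.
rewrite {1}/zpoint -mulrA zpoint_idem; case: m => k /=.
  elim: k => [|k IH]; first by rewrite expr0 mul1r add0r.
  by rewrite exprS -mulrA IH zpoint_s addrAC intS [1 + _]addrC.
elim: k => [|k IH]; first by rewrite expr1 zpoint_t addrC.
rewrite exprS -mulrA IH zpoint_t !NegzE (intS k.+1) opprD.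
by rewrite addrAC [- 1 + _]addrC.
Qed.

(* These elements span the left ideal generated by [p_{{z}}]. *)
Definition path_elt a j := sword s a * sword_star t (zw j) * e.

Lemma path_elt_s i a j : s i * path_elt a j = path_elt (i :: a) j.
Proof. by rewrite /path_elt sword_cons !mulrA. Qed.

(** [tproj A] moves right through [sword s a] and [e] moves left through the adjoint. They meet as a
    product with the projection of an atom, which [tproj_point] evaluates. *)
Lemma path_elt_p A a j : balg X A ->
  P A * path_elt a j = path_elt a j \/ P A * path_elt a j = 0.
Proof.
move=> hA; have [hr sr _] := tproj_word sX X_letters hf a hA.
rewrite /path_elt -(mulrA (sword s a)) star_point !mulrA sr.
rewrite -(mulrA (sword s a)) (tproj_point hf) //; last exact: balg_shift.
by case: ifP => _; [left|right; rewrite mulr0 mul0r].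
Qed.

Lemma path_elt_t i a j :
  (exists b k, t i * path_elt a j = path_elt b k) \/ t i * path_elt a j = 0.
Proof.
case: a => [|b a].
  rewrite /path_elt sword_nil mul1r.
  have [->|zi] := pselect (i = z j).
    (* The matching letter extends the prefix of [z] to length [j.+1], since adjoints multiply in
       reverse order. *)
    left; exists [::], j.+1; rewrite sword_nil mul1r mkseqS -cats1.
    by rewrite sword_star_cat sword_star1 mulrA.
  right; rewrite star_point mulrA.
  (* The sequence [shift j z] begins with [z j], not with [i], so its range along [i] is empty. *)
  have [_ _ ->] := transports_balg sX X_letters hf i (balg_shift j).
  rewrite rel_range_point //; last exact: subshift_shift.
  case: eqP => [[iz]|_]; first by case: zi; rewrite iz /shift addn0.
  by rewrite (tproj0 hf) !mul0r.
have [->|ib] := pselect (i = b); last first.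
  by right; rewrite -path_elt_s mulrA (letter_orth sX X_letters hf ib) mul0r.
rewrite -path_elt_s mulrA (letter_source X_letters hf).
case: (@path_elt_p (cyl X [:: b] [::]) a j) => [|->|->]; last by right.
  by apply: cyl_balg => //; left.
by left; exists a, j.
Qed.

Lemma path_elt_corner a j :
  (exists n, e * path_elt a j = zpoint n) \/ e * path_elt a j = 0.
Proof.
have [_ sr _] := tproj_word sX X_letters hf a hz.
have E : e * path_elt a j = sword s a *
    (P (rel_range X [set z] a) * P [set shift j z]) * sword_star t (zw j).
  by rewrite /path_elt -(mulrA (sword s a)) star_point !mulrA sr.
have [aE|aN] := eqVneq a (zw (size a)); last first.
  right; rewrite E rel_range_point // (negPf aN) (tproj0 hf).
  by rewrite mul0r mulr0 mul0r.
have [zE|zN] := pselect (shift (size a) z = shift j z); last first.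
  right; rewrite E aE rel_range_zw (tproj_point hf); try exact: balg_shift.
  rewrite memNset ?mulr0 ?mul0r //= => zE; exact/zN/esym.
(* The two projections in the middle now coincide, so multiplication by [e] leaves the element
   unchanged. *)
left; have {}E : e * path_elt a j = path_elt a j.
  rewrite E {2}aE rel_range_zw zE -(tprojI hf) ?setIid; try exact: balg_shift.
  by rewrite -mulrA -star_point mulrA.
(* By minimality the two lengths differ by a multiple of [size c]. The prefix of the shorter length
   cancels by [point_range], and the excess is a power of [sword_star t c] or of [sword s c]. *)
rewrite E /path_elt aE; case: (leqP (size a) j) => [aj|/ltnW ja].
  have /dvdnP[k kE] : (size c %| j - size a)%N.
    by apply: (minimal_shift_inj sX c_cycle (i := size a)); rewrite subnKC.
  exists (- k%:Z); rewrite -(subnK aj) kE zw_size sword_star_cat sword_star_zw.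
  rewrite /zpoint sword_zpowN -!mulrA point_tX.
  by rewrite !mulrA point_range.
have /dvdnP[k kE] : (size c %| size a - j)%N.
  by apply: (minimal_shift_inj sX c_cycle (i := j)); rewrite subnKC.
exists k%:Z; rewrite -(subnK ja) kE zw_size sword_cat sword_zw.
by rewrite -!mulrA (mulrA _ _ e) point_range.
Qed.

End Cycle.

(** * The graded representation *)

Section Endomorphisms.
Context (R : comPzRingType) (M : lmodType R).

Definition is_linear_map : {pred M -> M} := fun f => `[< linear f >].

Record endo := Endo {
  endo_fun :> M -> M;
  endoP : is_linear_map endo_fun
}.

HB.instance Definition _ := [isSub for endo_fun].
HB.instance Definition _ := [Choice of endo by <:].

Lemma endo_linear (f : endo) : linear f.
Proof. exact/asboolP/endoP. Qed.

Lemma endo_eq (f g : endo) : (forall v, f v = g v) -> f = g.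
Proof. by move=> fg; apply: val_inj; apply/funext. Qed.

Fact endo_zmod_closed : zmod_closed is_linear_map.
Proof.
split=> [|f g]; rewrite -!topredE /=.
  by apply/asboolP => k u v; rewrite /= scaler0 addr0.
move=> /asboolP hf /asboolP hg; apply/asboolP => k u v.
by rewrite !fctE hf hg scalerBr opprD addrACA.
Qed.
HB.instance Definition _ :=
  GRing.isZmodClosed.Build (M -> M) is_linear_map endo_zmod_closed.
HB.instance Definition _ := [SubChoice_isSubZmodule of endo by <:].

Lemma endoDE (f g : endo) v : (f + g) v = f v + g v.
Proof. by rewrite -[LHS]/(val (f + g) v) raddfD. Qed.

Fact endo_scale_subproof k (f : endo) : is_linear_map (fun v => k *: f v).
Proof.
apply/asboolP => l u v; rewrite endo_linear scalerDr.
by rewrite !scalerA mulrC.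
Qed.
Definition endo_scale k f := Endo (endo_scale_subproof k f).

Fact endo_scaleA a b f : endo_scale a (endo_scale b f) = endo_scale (a * b) f.
Proof. by apply: endo_eq => v; rewrite /= scalerA. Qed.
Fact endo_scale1 : left_id 1 endo_scale.
Proof. by move=> f; apply: endo_eq => v; rewrite /= scale1r. Qed.
Fact endo_scaleDr : right_distributive endo_scale +%R.
Proof.
move=> k f g; apply: endo_eq => v.
by rewrite endoDE -[LHS]/(k *: (f + g) v) endoDE scalerDr.
Qed.
Fact endo_scaleDl f : {morph endo_scale^~ f : a b / a + b}.
Proof. by move=> a b; apply: endo_eq => v; rewrite endoDE /= scalerDl. Qed.

Fact endo_one_subproof : is_linear_map id.
Proof. by apply/asboolP. Qed.
Definition endo_one := Endo endo_one_subproof.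

Fact endo_mul_subproof (f g : endo) : is_linear_map (f \o g).
Proof. by apply/asboolP => k u v; rewrite /= !endo_linear. Qed.
Definition endo_mul f g := Endo (endo_mul_subproof f g).

Fact endo_mulA : associative endo_mul.
Proof. by move=> f g h; exact: endo_eq. Qed.
Fact endo_mul1l : left_id endo_one endo_mul.
Proof. by move=> f; exact: endo_eq. Qed.
Fact endo_mul1r : right_id endo_one endo_mul.
Proof. by move=> f; exact: endo_eq. Qed.
Fact endo_mulDl : left_distributive endo_mul +%R.
Proof.
move=> f g h; apply: endo_eq => v.
by rewrite endoDE -[LHS]/((f + g) (h v)) endoDE.
Qed.
Fact endo_mulDr : right_distributive endo_mul +%R.
Proof.
move=> f g h; apply: endo_eq => v.
rewrite endoDE -[LHS]/(f ((g + h) v)) endoDE.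
by rewrite -[g v]scale1r endo_linear !scale1r.
Qed.
HB.instance Definition _ := GRing.Zmodule_isPzRing.Build endo
  endo_mulA endo_mul1l endo_mul1r endo_mulDl endo_mulDr.

Fact endo_scaleAl k (f g : endo) : endo_scale k (f * g) = endo_scale k f * g.
Proof. exact: endo_eq. Qed.
Fact endo_scaleAr k (f g : endo) : endo_scale k (f * g) = f * endo_scale k g.
Proof.
apply: endo_eq => v /=; have f0 : f 0 = 0.
  by have := endo_linear f (-1) 0 0; rewrite scaler0 addr0 scaleN1r addNr.
by rewrite -[k *: g v]addr0 endo_linear f0 addr0.
Qed.

(** The endomorphism algebra, bundled in the form over which the universal property of the subshift
    algebra quantifies. *)
Definition endo_alg : pzAlgType R := PzAlgType endo_scaleA endo_scale1
  endo_scaleDr endo_scaleDl endo_scaleAl endo_scaleAr.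

End Endomorphisms.

(* The representation of the subshift algebra on the functions [X -> int -> R];
   the [int] coordinate records the degree, so that distinct powers of [s_c] act
   differently even though they all fix the point [winf c]. *)
Section Representation.
Context (R : comPzRingType) (T : pointedType) (X : set (nat -> T)).
Hypothesis sX : is_subshift X.
Implicit Types (A : set (nat -> T)) (a b : seq T) (i : T) (x y : nat -> T).
Implicit Types (k l m : int).

Definition graded_fun := {x : nat -> T | X x} -> int -> R^o.
HB.instance Definition _ := GRing.Lmodule.on graded_fun.
Implicit Types f g : graded_fun.

(** Extension by zero outside [X] lets the operators be evaluated at arbitrary sequences, without
    carrying membership proofs. *)
Definition ext0 f y k : R :=
  if pselect (X y) is left h then f (exist _ y h) k else 0.

Definition restr (F : (nat -> T) -> int -> R) : graded_fun :=
  fun u k => F (sval u) k.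

Lemma ext0_inj f g : (forall y k, ext0 f y k = ext0 g y k) -> f = g.
Proof.
move=> fg; apply/funext => -[y hy]; apply/funext => k; have := fg y k.
by rewrite /ext0; case: pselect => // h; rewrite (Prop_irrelevance h hy).
Qed.

Lemma ext0_out f y k : ~ X y -> ext0 f y k = 0.
Proof. by rewrite /ext0; case: pselect. Qed.

Lemma ext0_restr F y k : ext0 (restr F) y k = if y \in X then F y k else 0.
Proof.
rewrite /ext0; case: pselect => h; first by rewrite mem_set.
by rewrite memNset.
Qed.

Lemma ext0_linear r f g y k :
  ext0 (r *: f + g) y k = r * ext0 f y k + ext0 g y k.
Proof. by rewrite /ext0; case: pselect => // _; rewrite mulr0 addr0. Qed.

Lemma restr_linear (F : graded_fun -> (nat -> T) -> int -> R) :
  (forall r f g y k, F (r *: f + g) y k = r * F f y k + F g y k) ->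
  is_linear_map (fun f => restr (F f)).
Proof.
move=> hF; apply/asboolP => r f g; apply/funext => y; apply/funext => k.
by rewrite /restr hF.
Qed.

Definition op_p A f := restr (fun y k => if y \in A then ext0 f y k else 0).
(** Pushforward along [(x, k) -> (i x, k + 1)], hence the backward shift in both arguments; [op_t]
    is the matching pullback, zero where [i y] leaves [X]. *)
Definition op_s i f :=
  restr (fun y k => if y 0%N == i then ext0 f (shift 1 y) (k - 1) else 0).
Definition op_t i f := restr (fun y k => ext0 f (wcat [:: i] y) (k + 1)).

Fact op_p_linear A : is_linear_map (op_p A).
Proof.
apply: restr_linear => r f g y k; rewrite ext0_linear.
by case: ifP => //; rewrite mulr0 addr0.
Qed.
Fact op_s_linear i : is_linear_map (op_s i).
Proof.
apply: restr_linear => r f g y k; rewrite ext0_linear.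
by case: ifP => //; rewrite mulr0 addr0.
Qed.
Fact op_t_linear i : is_linear_map (op_t i).
Proof. by apply: restr_linear => r f g y k; rewrite ext0_linear. Qed.

Local Notation E := (endo_alg graded_fun).

Definition rep_p A (_ : balg X A) : E := Endo (op_p_linear A).
Definition rep_s i : E := Endo (op_s_linear i).
Definition rep_t i : E := Endo (op_t_linear i).

Lemma endo_mulE (u v : E) f : (u * v : E) f = u (v f).
Proof. by []. Qed.

Lemma endo_addE (u v : E) f : (u + v : E) f = u f + v f.
Proof. exact: endoDE. Qed.

Lemma ext0_p A (h : balg X A) f y k :
  ext0 (rep_p h f) y k = if y \in A then ext0 f y k else 0.
Proof.
rewrite ext0_restr; case: ifPn => // yX; case: ifPn => // /set_mem/(sub_balg h).
by move=> /mem_set; rewrite (negPf yX).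
Qed.

Lemma ext0_s i f y k : ext0 (rep_s i f) y k =
  if (y 0%N == i) && (y \in X) then ext0 f (shift 1 y) (k - 1) else 0.
Proof. by rewrite ext0_restr; case: (_ == _) => //=; case: ifP. Qed.

Lemma ext0_t i f y k : ext0 (rep_t i f) y k = ext0 f (wcat [:: i] y) (k + 1).
Proof.
rewrite ext0_restr; case: ifPn => //; rewrite notin_setE => yX.
by rewrite ext0_out // => /(subshift_wcat sX).
Qed.

Lemma ext0_sword a f y k : ext0 (sword rep_s a f) y k =
  if (mkseq y (size a) == a) && (y \in X)
  then ext0 f (shift (size a) y) (k - (size a)%:Z) else 0.
Proof.
elim: a y k => [|i a IH] y k.
  rewrite sword_nil /= subr0; case: ifPn => //.
  by rewrite notin_setE => /ext0_out ->.
rewrite sword_cons endo_mulE ext0_s IH shiftD -[size (i :: a)]/(1 + size a)%N.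
rewrite PoszD opprD addrA mkseqD -[i :: a]/([:: i] ++ a) eqseq_cat //.
rewrite [mkseq y 1]/= eqseq_cons andbT -andbA; case: eqP => //= _.
(* As [shift 1 y] is in [X] whenever [y] is, the two membership tests reduce to one. *)
case: (boolP (y \in X)) => [/set_mem yX|]; last by rewrite andbF.
by rewrite (mem_set (subshift_shift 1 sX yX)) !andbT.
Qed.

Lemma ext0_sword_star a f y k : ext0 (sword_star rep_t a f) y k =
  ext0 f (wcat a y) (k + (size a)%:Z).
Proof.
elim: a f => [|i a IH] f; first by rewrite sword_star_nil wcat0 addr0.
rewrite sword_star_cons endo_mulE IH ext0_t (wcat_cons i a) -addrA.
by rewrite -PoszD addn1.
Qed.

Lemma rep_family : subshift_family rep_p rep_s rep_t.
Proof.
have ext0P (u v : E) :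
    (forall f y k, ext0 (u f) y k = ext0 (v f) y k) -> u = v.
  by move=> uv; apply: endo_eq => f; apply: ext0_inj => y k; exact: uv.
split.
- move=> h; apply: ext0P => f y k; rewrite ext0_p; case: ifPn => //.
  by rewrite notin_setE => /ext0_out ->.
- move=> A1 A2 h1 h2 h; apply: ext0P => f y k; rewrite endo_mulE !ext0_p in_setI.
  by case: (y \in A1).
(* The intersection term is moved across, so that both sides are sums and [ext0_linear] applies. *)
- move=> A1 A2 h1 h2 h h'; apply/eqP; rewrite eq_sym subr_eq; apply/eqP.
  apply: ext0P => f y k; rewrite !endo_addE.
  rewrite -[rep_p h1 f]scale1r -[rep_p h f]scale1r !ext0_linear !mul1r !ext0_p.
  rewrite in_setI in_setU.
  by case: (y \in A1); case: (y \in A2); rewrite ?addr0 ?add0r.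
- move=> h; apply: endo_eq => f; apply: ext0_inj => y k.
  by rewrite ext0_p in_set0 /ext0; case: pselect.
- move=> i; apply: ext0P => f y k; rewrite !endo_mulE !ext0_s ext0_t ext0_s.
  case: ifPn => // /andP[/eqP <- yX].
  have := wcat_mkseq y 1; rewrite -[mkseq y 1]/[:: y 0%N] => ->.
  by rewrite eqxx yX subrK.
- move=> i; apply: ext0P => f y k; rewrite !endo_mulE !ext0_t ext0_s ext0_t.
  rewrite (shift_wcat [:: i]) addrK eqxx /=; case: ifPn => //.
  by rewrite notin_setE => /ext0_out ->.
move=> a b ha hb h; apply: ext0P => f y k; rewrite !endo_mulE.
(* At [(y, k)] the product tests that [y] is in [X] and begins with [b], and that replacing this [b]
   by [a] stays in [X]. It then reads [f] at [(y, k)] itself, the degree shifts having cancelled. *)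
rewrite ext0_sword ext0_sword_star ext0_sword ext0_sword_star ext0_p.
rewrite mkseq_wcat shift_wcat eqxx /= addrK subrK.
case: eqP => [yb|yb] /=; last first.
  rewrite memNset // => /cylP[x [yE _ _]].
  by apply: yb; rewrite yE mkseq_wcat.
have yE : wcat b (shift (size b) y) = y by apply/wcat_eq.
rewrite yE; case: ifPn => yX; last first.
  by rewrite memNset // => /(sub_balg h) /mem_set; apply/negP.
case: ifPn => [/set_mem xX|xX].
  rewrite mem_set //; apply/cylP; exists (shift (size b) y); rewrite yE.
  by split=> //; exact: set_mem.
rewrite memNset // => /cylP[x [yE' ax _]]; move: xX; rewrite notin_setE.
by rewrite yE' shift_wcat.
Qed.

Definition dirac x k : graded_fun :=
  restr (fun y l => ((y == x) && (l == k))%:R).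

Lemma ext0_dirac x k y l : X x ->
  ext0 (dirac x k) y l = ((y == x) && (l == k))%:R.
Proof.
move=> hx; rewrite ext0_restr; case: ifPn => //; rewrite notin_setE => hy.
by case: eqP => // yx; case: hy; rewrite yx.
Qed.

Lemma rep_sword_dirac a x k : X (wcat a x) ->
  sword rep_s a (dirac x k) = dirac (wcat a x) (k + (size a)%:Z).
Proof.
move=> hax; have hx := subshift_wcat sX hax; apply: ext0_inj => y l.
rewrite ext0_sword !ext0_dirac // subr_eq.
have -> : (y == wcat a x) = (mkseq y (size a) == a) && (shift (size a) y == x).
  apply/eqP/andP => [->|[/eqP ya /eqP yx]].
    by rewrite mkseq_wcat shift_wcat.
  by apply/esym/wcat_eq.
case: eqP => [ya|] //=; case: eqP => [yx|] /=; last by rewrite if_same.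
have yE : wcat a x = y by apply/wcat_eq.
by rewrite mem_set // -yE.
Qed.

Lemma rep_sword_star_dirac a x k : X (wcat a x) ->
  sword_star rep_t a (dirac (wcat a x) k) = dirac x (k - (size a)%:Z).
Proof.
move=> hax; have hx := subshift_wcat sX hax; apply: ext0_inj => y l.
rewrite ext0_sword_star !ext0_dirac // (inj_eq (@wcat_inj _ a)).
by rewrite [l == _]eq_sym subr_eq [k == _]eq_sym.
Qed.

End Representation.

(** * Coefficients read off from the representation *)

Section Coefficients.
Context (R : comPzRingType) (T : pointedType) (X : set (nat -> T)).
Hypothesis sX : is_subshift X.
Context (c : seq T) (z_balg : balg X [set winf c]).
Hypothesis c0 : c <> [::].

Local Notation z := (winf c).

Lemma alg_homX (A B : pzAlgType R) (f : A -> B) (hf : alg_hom f) x n :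
  f (x ^+ n) = f x ^+ n.
Proof.
by elim: n => [|n IH]; rewrite ?expr0 ?(alg_hom1 hf) // !exprS (alg_homM hf) IH.
Qed.

Definition graded_rep : subshift_alg R X -> endo_alg (graded_fun R X) :=
  salg_lift (@rep_p R T X) (@rep_s R T X) (@rep_t R T X).

Lemma graded_rep_hom : alg_hom graded_rep.
Proof. exact: salg_lift_hom (rep_family R sX). Qed.

Lemma graded_rep_zpow n :
  graded_rep (sword_zpow sgen sgen_star c n * pr R z_balg) =
  sword_zpow (@rep_s R T X) (@rep_t R T X) c n * rep_p R z_balg.
Proof.
have rF := rep_family R sX; rewrite (alg_homM graded_rep_hom).
congr (_ * _); last first.
  exact: salg_liftE.
case: n => n; rewrite /= (alg_homX graded_rep_hom) (alg_hom_prod graded_rep_hom).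
  by congr (_ ^+ _); apply: eq_bigr => i _; exact: salg_liftE.
by congr (_ ^+ _); apply: eq_bigr => i _; exact: salg_liftE.
Qed.

Lemma graded_rep_dirac n :
  graded_rep (sword_zpow sgen sgen_star c n * pr R z_balg) (@dirac R T X z 0) =
  @dirac R T X z (n * (size c)%:Z).
Proof.
have Xz : X z by exact: (sub_balg z_balg).
have Xcz : X (wcat c z) by rewrite wcat_winf.
rewrite graded_rep_zpow endo_mulE.
have -> : rep_p R z_balg (@dirac R T X z 0) = @dirac R T X z 0.
  apply: ext0_inj => y k; rewrite ext0_p ext0_dirac //.
  case: ifPn => //; rewrite notin_setE /= => /eqP yz.
  by rewrite (negPf yz).
case: n => n /=.
  elim: n => [|n IH]; first by rewrite expr0 mul0r.
  rewrite exprS endo_mulE IH rep_sword_dirac // wcat_winf //.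
  by rewrite intS mulrDl mul1r addrC.
rewrite NegzE; elim: n.+1 => [|{}n IH]; first by rewrite expr0 oppr0 mul0r.
rewrite exprS endo_mulE IH -{1}(wcat_winf c0).
by rewrite rep_sword_star_dirac // intS opprD mulrDl mulN1r addrC.
Qed.

(** The [n]-th power carries the Dirac function at [(z, 0)] to degree [n * size c], so evaluation at
    degree [k * size c] isolates the coefficient of the [k]-th power. *)
Definition zcoef (k : int) (x : subshift_alg R X) : R :=
  ext0 (graded_rep x (@dirac R T X z 0)) z (k * (size c)%:Z).

Lemma zcoef_linear k r x y : zcoef k (r *: x + y) = r * zcoef k x + zcoef k y.
Proof.
by rewrite /zcoef graded_rep_hom.1 endo_addE -ext0_linear.
Qed.

Lemma zcoef_zpow k n :
  zcoef k (sword_zpow sgen sgen_star c n * pr R z_balg) = (k == n)%:R.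
Proof.
rewrite /zcoef graded_rep_dirac ext0_dirac ?eqxx /=.
  2: exact: (sub_balg z_balg).
(* Multiplication by [size c] is injective on exponents because [c] is nonempty. *)
by rewrite (inj_eq (mulIf _)) //; case: c c0.
Qed.

End Coefficients.

(** * Spans and dual functionals *)

Section Span.
Context (R : comPzRingType) (V : lmodType R).

(** The submodule generated by [S], built one scaled generator at a time so that span arguments are
    inductions rather than manipulations of indexed sums. *)
Inductive lspan (S : set V) : V -> Prop :=
| lspan0 : lspan S 0
| lspanZD k x y : S x -> lspan S y -> lspan S (k *: x + y).

Lemma lspanD S x y : lspan S x -> lspan S y -> lspan S (x + y).
Proof.
elim=> [|k u v Su _ IH] hy; first by rewrite add0r.
by rewrite -addrA; apply: lspanZD => //; exact: IH.
Qed.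

Lemma lspan_gen S x : S x -> lspan S x.
Proof.
move=> Sx; rewrite -[x]addr0 -[x]scale1r.
by apply: lspanZD => //; exact: lspan0.
Qed.

Lemma lspanZ S k x : lspan S x -> lspan S (k *: x).
Proof.
elim=> [|l u v Su _ IH]; first by rewrite scaler0; exact: lspan0.
by rewrite scalerDr scalerA; apply: lspanZD.
Qed.

End Span.

(** * Bases from a spanning family with dual functionals *)

Section LaurentBasis.
Context (R : comPzRingType) (V : lmodType R) (U : int -> V) (l : int -> V -> R).
Hypothesis l_linear : forall k r x y, l k (r *: x + y) = r * l k x + l k y.
Hypothesis l_dual : forall k n, l k (U n) = (k == n)%:R.
Hypothesis U_span : forall x, lspan (range U) x.

Lemma l0 k : l k 0 = 0.
Proof.
by have := l_linear k (-1) 0 0; rewrite scaler0 addr0 mulN1r addNr.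
Qed.

(** Allowing every larger [F'] lets two elements be expanded over a common index set. *)
Lemma dual_expansion x : exists F : {fset int},
  (forall k, k \notin F -> l k x = 0) /\
  forall F' : {fset int}, (F `<=` F')%fset -> x = \sum_(k <- F') l k x *: U k.
Proof.
elim: {x}(U_span x) => [|r _ y [n _ <-] _ [F [lF yF]]].
  exists fset0; split=> [k _|F' _]; first exact: l0.
  by rewrite big1 // => k _; rewrite l0 scale0r.
exists (n |` F)%fset; split=> [k|F'].
  rewrite in_fset1U negb_or => /andP[/negPf kn /lF ly].
  by rewrite l_linear l_dual kn ly mulr0 addr0.
move=> /fsubsetP sF; rewrite {1}(yF F'); last first.
  by apply/fsubsetP => k kF; apply: sF; rewrite in_fset1U kF orbT.
under [RHS]eq_bigr => k _ do rewrite l_linear l_dual scalerDl.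
rewrite big_split /=; congr (_ + _).
(* Only the index [n] contributes to the sum of the new terms, giving [r *: U n]. *)
rewrite (big_fsetD1 n) /=; last by apply: sF; rewrite in_fset1U eqxx.
rewrite eqxx mulr1 big_seq big1 ?addr0 // => k.
by rewrite in_fsetD1 => /andP[/negPf -> _]; rewrite mulr0 scale0r.
Qed.

Fact dual_laurent_subproof x : in_laurent (fun k => l k x).
Proof. by apply/laurent_setP; have [F [lF _]] := dual_expansion x; exists F. Qed.

Definition dual_laurent x : laurent R := Laurent (dual_laurent_subproof x).

Lemma dual_laurent_linear : linear dual_laurent.
Proof. by move=> r x y; apply: laurentP => k; rewrite lcoefD /= l_linear. Qed.

Lemma dual_laurent_gen n : dual_laurent (U n) = laurentX R n.
Proof. by apply: laurentP => k; rewrite /= l_dual. Qed.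

Lemma linear_eq_span (W : lmodType R) (f g : V -> W) :
  linear f -> linear g -> (forall n, f (U n) = g (U n)) -> f =1 g.
Proof.
move=> hf hg fg x.
have z (h : V -> W) : linear h -> h 0 = 0.
  by move=> hh; have := hh (-1) 0 0; rewrite scaler0 addr0 scaleN1r addNr.
elim: {x}(U_span x) => [|r _ y [n _ <-] _ IH]; first by rewrite !z.
by rewrite hf hg fg IH.
Qed.

Lemma l_sum k (F : {fset int}) (g : int -> R) :
  l k (\sum_(n <- F) g n *: U n) = \sum_(n <- F) g n * (k == n)%:R.
Proof.
apply: (big_ind2 (fun v b => l k v = b)) => [|x _ y _ <- <-|n _].
- exact: l0.
- by rewrite -{1}[x]scale1r l_linear mul1r.
by rewrite -[_ *: _]addr0 l_linear l0 addr0 l_dual.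
Qed.

(** Injectivity compares two expansions over the union of their index sets; a preimage of [f] is the
    combination of the [U n] with coefficients [f n]. *)
Lemma dual_laurent_bij : bijective dual_laurent.
Proof.
rewrite -setTT_bijective; split=> // [x y _ _ xy|f _].
  have [F [_ xF]] := dual_expansion x; have [G [_ yG]] := dual_expansion y.
  rewrite (xF _ (fsubsetUl F G)) (yG _ (fsubsetUr F G)).
  apply: eq_bigr => k _; congr (_ *: _).
  exact: (congr1 (fun h => lcoef h k) xy).
have [F fF] := laurent_supp f; exists (\sum_(n <- F) f n *: U n) => //.
apply: laurentP => k; rewrite /= l_sum.
have [kF|kF] := boolP (k \in F).
  rewrite (big_fsetD1 k) //= eqxx mulr1 big_seq big1 ?addr0 // => n.
  by rewrite in_fsetD1 eq_sym => /andP[/negPf -> _]; rewrite mulr0.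
rewrite fF // big_seq big1 // => n nF; case: eqP => [kn|]; last by rewrite mulr0.
by rewrite kn nF in kF.
Qed.

End LaurentBasis.

(** * The corner *)

(** Structural induction on a representing formal expression, whose constructors [sclassD] and its
    companions turn into the algebra operations. *)
Lemma subshift_alg_ind (R : comPzRingType) (T : pointedType)
    (X : set (nat -> T)) (Q : subshift_alg R X -> Prop) :
    (forall A (h : balg X A), Q (pr R h)) ->
    (forall i, Q (sgen i)) -> (forall i, Q (sgen_star i)) ->
    Q 0 -> Q 1 ->
    (forall x y, Q x -> Q y -> Q (x + y)) -> (forall x, Q x -> Q (- x)) ->
    (forall x y, Q x -> Q y -> Q (x * y)) ->
    (forall k x, Q x -> Q (k *: x)) ->
  forall x, Q x.
Proof.
move=> hp hs ht h0 h1 hD hN hM hZ x; rewrite -[x]reprK -/(srepr x) -/(sclass _).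
elim: (srepr x) => //= [u hu v hv|u hu|u hu v hv|k u hu].
- by rewrite sclassD; apply: hD.
- by rewrite sclassN; apply: hN.
- by rewrite sclassM; apply: hM.
- by rewrite sclassZ; apply: hZ.
Qed.

Section Corner.
Context (R : comPzRingType) (T : pointedType) (X : set (nat -> T)).
Hypotheses (sX : is_subshift X) (X_letters : forall i : T, language X [:: i]).
Context (c : seq T) (z_balg : balg X [set winf c]).
Hypothesis c_cycle : minimal_cycle_without_exit X [set winf c] c.

Local Notation e := (pr R z_balg).
Local Notation SA := (subshift_alg R X).
Let u (n : int) : SA := sword_zpow sgen sgen_star c n * e.
Let hf := subshift_alg_family R X.

Lemma zpoint_sgen n : zpoint (@pr R T X) sgen sgen_star c n = u n.
Proof. by rewrite /zpoint -tprojE. Qed.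

Let path_elts : set SA :=
  [set v | exists a j, v = path_elt (@pr R T X) sgen sgen_star c a j].

Lemma left_ideal_span x : lspan path_elts (x * e).
Proof.
set W := lspan _.
(* Stability under left multiplication is a form that passes through products; [e] is the path
   element for the empty word and [j = 0]. *)
suff h : forall y : SA, W y -> W (x * y).
  apply: h; apply: lspan_gen; exists [::], 0%N.
  by rewrite /path_elt sword_nil sword_star_nil !mul1r -tprojE.
have WL (y : SA) :
    (forall v, path_elts v -> W (y * v)) -> forall v, W v -> W (y * v).
  move=> hy v; elim=> [|k v1 v2 Sv _ IH]; first by rewrite mulr0; exact: lspan0.
  by rewrite mulrDr -pzscalerAr; apply: lspanD => //; apply/lspanZ/hy.
elim/subshift_alg_ind: x.
- move=> A hA; apply: WL => _ [a [j ->]]; rewrite (tprojE _ hA).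
  have [->|->] := path_elt_p sX X_letters hf c_cycle a j hA; last exact: lspan0.
  by apply: lspan_gen; exists a, j.
- move=> i; apply: WL => _ [a [j ->]]; rewrite path_elt_s.
  by apply: lspan_gen; exists (i :: a), j.
- move=> i; apply: WL => _ [a [j ->]].
  have [[b [k ->]]|->] := path_elt_t sX X_letters hf c_cycle i a j.
  2: exact: lspan0.
  by apply: lspan_gen; exists b, k.
- by move=> y _; rewrite mul0r; exact: lspan0.
- by move=> y; rewrite mul1r.
- by move=> x1 x2 h1 h2 y hy; rewrite mulrDl; apply: lspanD; [apply: h1|apply: h2].
- move=> x1 h1 y hy; rewrite mulNr -scaleN1r; apply: lspanZ; exact: h1.
- by move=> x1 x2 h1 h2 y hy; rewrite -mulrA; apply/h1/h2.
- by move=> k x1 h1 y hy; rewrite -pzscalerAl; apply/lspanZ/h1.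
Qed.

Lemma corner_span x : lspan (range u) (e * x * e).
Proof.
rewrite -mulrA; elim: (left_ideal_span x) => [|k v w [a [j ->]] _ IH].
  by rewrite mulr0; exact: lspan0.
rewrite mulrDr -pzscalerAr; apply: lspanD IH; apply: lspanZ.
rewrite (tprojE _ z_balg).
have [[n ->]|->] := path_elt_corner sX X_letters hf c_cycle a j.
  2: exact: lspan0.
by rewrite zpoint_sgen; apply: lspan_gen; exists n.
Qed.

Lemma zpow_corner n : u n \in corner_set e.
Proof.
rewrite corner_setE ?pr_idem // -zpoint_sgen (tprojE _ z_balg).
rewrite (zpoint_idem sX X_letters hf c_cycle) /zpoint -mulrA.
by rewrite -(tprojE _ z_balg) pr_idem.
Qed.

Lemma zpowM m n : u m * u n = u (m + n).
Proof. by rewrite -!zpoint_sgen (zpointM sX X_letters hf c_cycle). Qed.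

Definition ucorner n : corner (pr_idem R z_balg) :=
  Corner _ (u n) (zpow_corner n).

Lemma ucorner_span x : lspan (range ucorner) x.
Proof.
have /set_mem[y _ yx] := valP x; have := corner_span y; rewrite yx.
(* Each partial combination is lifted to the corner, where the generators have lifts [ucorner n];
   injectivity of [val] identifies the lift with [x]. *)
move=> hx; suff h : forall v, lspan (range u) v ->
    exists2 w : corner (pr_idem R z_balg), lspan (range ucorner) w & val w = v.
  by have [w hw /val_inj <-] := h _ hx.
move=> v; elim=> [|k _ v' [n _ <-] _ [w hw <-]].
  by exists 0; [exact: lspan0|].
exists (k *: ucorner n + w); first by apply: lspanZD => //; exists n.
by rewrite [LHS]corner_valD.
Qed.

End Corner.

Theorem lemma5p3 (R : comPzRingType) (T : pointedType) (X : set (nat -> T))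
    (X_subshift : is_subshift X)
    (X_letters : forall a : T, language X [:: a])
    (A : set (nat -> T)) (c : seq T) (A_balg : balg X A)
    (Ac_cycle : minimal_cycle_without_exit X A c) :
  let u (n : int) : subshift_alg R X :=
    sword_zpow sgen sgen_star c n * pr R A_balg in
  (forall n, u n \in corner_set (pr R A_balg)) /\
  exists psi : corner (pr_idem R A_balg) -> laurent R,
    unique (fun phi : corner (pr_idem R A_balg) -> laurent R =>
              linear phi /\
              forall n y, corner_val y = u n -> phi y = laurentX R n) psi /\
    alg_hom psi /\ bijective psi.
Proof.
move=> u; have [[[_ c0 _ _ _] AE] _] := Ac_cycle; subst A.
split=> [n|]; first exact: zpow_corner.
pose U := ucorner R X_subshift X_letters A_balg Ac_cycle.
pose l k (x : corner (pr_idem R A_balg)) := zcoef c k (val x).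
have l_linear k r x y : l k (r *: x + y) = r * l k x + l k y.
  by rewrite /l [val _]corner_valD -(zcoef_linear X_subshift).
have l_dual k n : l k (U n) = (k == n)%:R by exact: zcoef_zpow.
have U_span x : lspan (range U) x by exact: ucorner_span.
pose psi := dual_laurent l_linear l_dual U_span.
have psi_lin : linear psi by exact: dual_laurent_linear.
have psiU n : psi (U n) = laurentX R n by exact: dual_laurent_gen.
exists psi; split; [split|split; [split=> //|]].
(* A corner element with value [u n] equals [U n], because [val] is injective. *)
- by split=> // n y yu; rewrite -psiU; congr psi; exact: val_inj.
- move=> phi [phi_lin phiU]; apply/funext.
  apply: (linear_eq_span U_span) => // n.
  by rewrite psiU (phiU n).
(* The unit of the corner is the zeroth power. Multiplicativity extends from the spanning family by
   linearity, first in the right factor and then in the left. *)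
- have U0 : U 0 = 1 by apply: val_inj; rewrite /= /sword_zpow expr0 mul1r.
  have UM m n : U m * U n = U (m + n) by apply: val_inj; exact: zpowM.
  split; first by rewrite -U0 psiU.
  have psiM n y : psi (U n * y) = laurentX R n * psi y.
    move: y; apply: (linear_eq_span U_span) => [r x y|r x y|m].
    + by rewrite mulrDr -corner_scaleAr psi_lin.
    + by rewrite psi_lin mulrDr -laurent_scaleAr.
    by rewrite UM !psiU laurentXD.
  move=> x y; move: x; apply: (linear_eq_span U_span) => [r x x'|r x x'|m].
  + by rewrite mulrDl -corner_scaleAl psi_lin.
  + by rewrite psi_lin mulrDl -laurent_scaleAl.
  by rewrite psiM psiU.
exact: dual_laurent_bij.
Qed.
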